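(* Let $\alpha>0$. There is a constant $C=C(\alpha)>0$ such that for every real sequence $v=(v_n)_{n\ge0}$ with $v^+\in\ell^{1+\alpha}(\mathbb{Z}_{\ge0};\sigma_\alpha^2)$ the operator $H_{\alpha,V}$ is bounded from below, its negative spectrum is discrete and, moreover, $$\kappa_-(H_{\alpha,V})\le C(\alpha)\sum_{n\ge0}(v_n^+)^{1+\alpha}\frac{(\alpha+1)_n}{n!}.$$ In particular $C(\alpha)$ is independent of $v$.
   Context: For $\alpha>-1$ and a complex sequence $u=(u_n)_{n\ge 0}$ (with $u_{-1}:=0$) put $$(\tau_\alpha u)_n=-\sqrt{n(n+\alpha)}\,u_{n-1}+(2n+1+\alpha)u_n-\sqrt{(n+1)(n+1+\alpha)}\,u_{n+1},\quad n\ge 0.$$ The discrete Laguerre operator $H_\alpha$ in $\ell^2(\mathbb{Z}_{\ge 0})$ is $H_\alpha u=\tau_\alpha u$ with maximal domain $\{u\in\ell^2(\mathbb{Z}_{\ge0}) : \tau_\alpha u\in\ell^2(\mathbb{Z}_{\ge0})\}$; it is self-adjoint and nonnegative. For a real sequence $v=(v_n)_{n\ge0}$, $V$ is multiplication by $v$, $(Vu)_n=v_nu_n$, and $H_{\alpha,V}=H_\alpha-V$ is the maximal operator $u\mapsto\tau_\alpha u-Vu$ on $\{u\in\ell^2(\mathbb{Z}_{\ge0}):\tau_\alpha u-Vu\in\ell^2(\mathbb{Z}_{\ge0})\}$, which is self-adjoint. $v^+:=(|v|+v)/2$. $\kappa_-(H_{\alpha,V})$ is the total multiplicity of the negative spectrum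 of $H_{\alpha,V}$, i.e. the dimension of the range of its spectral projection onto $(-\infty,0)$. $(x)_0:=1$, $(x)_n:=x(x+1)\cdots(x+n-1)$; $\sigma_\alpha(n)^2=\frac{(\alpha+1)_n}{n!}$; $\ell^{1+\alpha}(\mathbb{Z}_{\ge0};\sigma_\alpha^2)$ is the space of sequences with $\sum_{n\ge0}|u_n|^{1+\alpha}\sigma_\alpha(n)^2<\infty$. *)

(* Defs.v *)
From HB Require Import structures.
From mathcomp Require Import all_boot all_order all_algebra.
From mathcomp Require Import complex.
From mathcomp Require Import all_classical all_reals all_analysis.

Set Implicit Arguments.
Unset Strict Implicit.
Unset Printing Implicit Defensive.

Import Order.TTheory GRing.Theory Num.Theory.
Import numFieldNormedType.Exports.

Local Open Scope classical_set_scope.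
Local Open Scope complex_scope.
Local Open Scope ring_scope.

Section HilbertSpace.
Variable R : realType.

Definition cseq := nat -> R[i].

Definition sqnormc (z : R[i]) : R := complex.Re z ^+ 2 + complex.Im z ^+ 2.

Definition l2 : set cseq :=
  [set u | (\sum_(0 <= n <oo) (sqnormc (u n))%:E < +oo)%E].

Definition csum (f : cseq) : R[i] :=
  limn (series (fun n => complex.Re (f n))) +i*
  limn (series (fun n => complex.Im (f n))).

(* Linear in the first argument; the series converges (absolutely) on l2. *)
Definition inner (u w : cseq) : R[i] := csum (fun n => u n * (w n)^*).

Definition l2norm (u : cseq) : R :=
  Num.sqrt (limn (series (fun n => sqnormc (u n)))).

Definition lin_indep (n : nat) (f : 'I_n -> cseq) : Prop :=
  forall c : 'I_n -> R[i],
    (forall k, \sum_(i < n) c i * f i k = 0) -> forall i, c i = 0.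

(* Dimension of a linear subspace, with values in {0, 1, 2, ..., +oo}. *)
Definition edim (W : set cseq) : \bar R :=
  ereal_sup [set (n%:R)%:E | n in
    [set n : nat | exists f : 'I_n -> cseq, (forall i, W (f i)) /\ lin_indep f]].

(* Possibly unbounded operators in l2; only the values of [act] on [dom]
   are meaningful. *)
Record operator := Operator { dom : set cseq ; act : cseq -> cseq }.

Definition bounded_below (H : operator) : Prop :=
  exists m : R, forall u, dom H u -> m%:C * inner u u <= inner (act H u) u.

Definition resolvent_set (H : operator) : set R[i] :=
  [set z |
    (forall w, l2 w ->
       exists! u, dom H u /\ (forall n, act H u n - z * u n = w n)) /\
    (exists M : R, forall u, dom H u ->
       l2norm u <= M * l2norm (fun n => act H u n - z * u n))].

Definition spectrum (H : operator) : set R[i] := ~` resolvent_set H.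

Definition eigenspace (H : operator) (z : R[i]) : set cseq :=
  [set u | dom H u /\ forall n, act H u n = z * u n].

(* The spectrum in (-oo, 0) consists of isolated points of the spectrum that
   are eigenvalues of finite multiplicity (0 is allowed to be an
   accumulation point). *)
Definition discrete_negative_spectrum (H : operator) : Prop :=
  forall t : R, t < 0 -> spectrum H t%:C ->
    (exists2 e : R, 0 < e & forall z, spectrum H z -> `|z - t%:C| < e%:C -> z = t%:C) /\
    (0 < edim (eigenspace H t%:C) < +oo)%E.

Definition orthogonal_projection (P : cseq -> cseq) : Prop :=
  [/\ forall u, l2 u -> l2 (P u),
      forall (a : R[i]) u w, l2 u -> l2 w ->
        P (fun n => a * u n + w n) = (fun n => a * P u n + P w n),
      forall u, l2 u -> P (P u) = P u
    & forall u w, l2 u -> l2 w -> inner (P u) w = inner u (P w)].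

(* A projection-valued measure E on the Borel sets of the line with
   H = \int x dE(x), given together with its scalar measures
   B |-> <E(B) u, u>.  For orthogonal projections, countable additivity of all
   scalar measures is equivalent to strong countable additivity of E; the form
   u |-> <H u, u> determines H on its domain by polarization. *)
Record spectral_resolution (H : operator) := SpectralResolution {
  sproj : set (measurableTypeR R) -> cseq -> cseq ;
  smeas : cseq -> {measure set (measurableTypeR R) -> \bar R} ;
  sproj_orth : forall B, measurable B -> orthogonal_projection (sproj B) ;
  sprojT : forall u, l2 u -> sproj setT u = u ;
  smeasE : forall B u, measurable B -> l2 u ->
    smeas u B = (complex.Re (inner (sproj B u) u))%:E ;
  sdom : forall u,
    dom H u <-> l2 u /\ (\int[smeas u]_x ((x : R) ^+ 2)%:E < +oo)%E ;
  sact : forall u, dom H u -> l2 (act H u) /\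
    inner (act H u) u = (\int[smeas u]_x (x : R))%:C
}.

(* Dimension of the range of the spectral projection onto (-oo, 0). *)
Definition kappa_neg (H : operator) (E : spectral_resolution H) : \bar R :=
  edim (sproj E `]-oo, 0[ @` l2).

End HilbertSpace.

Section Laguerre.
Variable R : realType.

Definition tau (alpha : R) (u : cseq R) : cseq R := fun n =>
  - (Num.sqrt (n%:R * (n%:R + alpha)))%:C * (if n is m.+1 then u m else 0)
  + (n%:R *+ 2 + 1 + alpha)%:C * u n
  - (Num.sqrt (n.+1%:R * (n.+1%:R + alpha)))%:C * u n.+1.

Definition laguerre (alpha : R) (v : nat -> R) : operator R :=
  let T u := fun n => tau alpha u n - (v n)%:C * u n in
  Operator [set u | l2 u /\ l2 (T u)] T.

Definition vpos (v : nat -> R) : nat -> R := fun n => (`|v n| + v n) / 2.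

Definition pochhammer (x : R) (n : nat) : R := \prod_(i < n) (x + i%:R).

Definition sigma2 (alpha : R) (n : nat) : R := pochhammer (alpha + 1) n / n`!%:R.

Definition weighted_lp (p : R) (w : nat -> R) : set (nat -> R) :=
  [set u | (\sum_(0 <= n <oo) (`|u n| `^ p * w n)%:E < +oo)%E].

End Laguerre.

(* Main.v *)
Require Import Defs.
From mathcomp Require Import all_boot all_order all_algebra.
From mathcomp Require Import complex ring lra.
From mathcomp Require Import all_classical all_reals all_analysis measurable_realfun.
Import Order.TTheory GRing.Theory Num.Theory.
Import numFieldNormedType.Exports.
Local Open Scope ring_scope.

Set Implicit Arguments.
Unset Strict Implicit.
Unset Printing Implicit Defensive.

(** The sequence sigma(n) is annihilated by tau_alpha.  Writing u = sigma f, the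
quadratic form of H_alpha becomes the weighted Dirichlet energy
sum_n (n+1+alpha) sigma(n)^2 |f(n+1) - f(n)|^2, and because alpha > 0 the
resistance from n to infinity, sum_(k >= n) 1 / ((k+1+alpha) sigma(k)^2), is
finite and equal to 1 / (alpha sigma(n)^2).  Two facts about this energy carry
the estimate: the pointwise bound alpha |u(n)|^2 <= energy
([pointwise_energy]) and a Hardy inequality with weight 1/(n+1) ([hardy]).
Splitting a potential q as q <= s + q^(1+alpha) s^(-alpha) with s of order
1/(n+1), the first part is absorbed by the Hardy inequality and the second by
the pointwise bound, since (n+1)^alpha = O(sigma(n)^2).  Hence
sum q |u|^2 <= energy on any block of indices that carries at most a fixed
amount eps of the weight sum q^(1+alpha) sigma^2 and at whose right end u
vanishes or continues to infinity ([sobolev_block]).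

The half-line is cut greedily into such blocks: each cut is a point where u is
required to vanish, and each cut uses up more than eps of the total weight S.
So there is a set Z of at most S/eps points such that <H u, u> >= 0 for every u
in the domain that vanishes on Z ([dirichlet_points], [form_ge0_off_points]).
For u in the maximal domain the summation by parts behind this leaves a
boundary term of size (M+1)(|u(M)|^2 + |u(M+1)|^2); it is small for arbitrarily
large M since u is square-summable and the harmonic series diverges, which also
shows that H is symmetric.  If the range of the spectral projection onto
]-oo, 0[ had dimension larger than |Z|, it would contain a nonzero u vanishing
on Z; H being bounded below, the spectral measure of u lives on a bounded
negative interval, so u is in the domain and <H u, u> < 0, a contradiction.
This is the bound on kappa with C = 1/eps.

For the discreteness, let Re z < 0 and let phi be the solution of
(tau_alpha - v - z) phi = 0 with phi(0) = 1.  If phi is square-summable, z is an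
eigenvalue, hence real, and simple.  Otherwise z is in the resolvent set:
replacing v by min(v, -Re z / 2), which changes finitely many values because
v^+ tends to 0, makes the problem coercive, so that it is solved by truncation
and compactness ([coercive_solve]); the finite-rank difference is corrected by
combining phi with a decaying tail solution ([resolvent_solve]).  Finally, distinct
negative eigenvalues have orthogonal eigenvectors, so the same set Z bounds
their number, and each of them is isolated. *)

(** * The energy form and the Hardy inequality *)

Section EnergyInequalities.
Variables (R : realType) (alpha : R).
Hypothesis alpha_gt0 : 0 < alpha.
Implicit Types (a : nat -> R) (n m M : nat).

Definition offdiag n : R := Num.sqrt (n.+1%:R * (n.+1%:R + alpha)).

(** With a = sigma f this is (n+1+alpha) sigma(n)^2 (f(n+1) - f(n))^2, the energy of
the edge from n to n+1; equivalently the square of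
sqrt(n+1) a(n+1) - sqrt(n+1+alpha) a(n). *)
Definition edge a n : R :=
  n.+1%:R * a n.+1 ^+ 2 + (n.+1%:R + alpha) * a n ^+ 2
  - 2 * offdiag n * a n * a n.+1.

(** The last term is the least energy needed to continue a from M to infinity, so
that [energy] behaves like the energy of a sequence on the whole half-line. *)
Definition energy m M a : R := \sum_(m <= n < M) edge a n + alpha * a M ^+ 2.

(** The inequalities between neighbouring values of a sequence used below are
instances of this discriminant test. *)
Lemma quadratic_form_ge0 (P Q b x y : R) :
  0 < P -> b ^+ 2 <= P * Q -> 0 <= P * x ^+ 2 + Q * y ^+ 2 - 2 * b * x * y.
Proof.
move=> P0 bPQ; rewrite -(pmulr_rge0 _ P0).
have -> : P * (P * x ^+ 2 + Q * y ^+ 2 - 2 * b * x * y) =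
  (P * x - b * y) ^+ 2 + (P * Q - b ^+ 2) * y ^+ 2 by ring.
by rewrite addr_ge0 ?sqr_ge0// mulr_ge0 ?sqr_ge0// subr_ge0.
Qed.

Lemma succ_gt0 n : 0 < n.+1%:R :> R.
Proof. exact: ltr0Sn. Qed.

Lemma offdiag_sqr n : offdiag n ^+ 2 = n.+1%:R * (n.+1%:R + alpha).
Proof. by rewrite sqr_sqrtr// mulr_ge0// addr_ge0// ltW. Qed.

Lemma offdiag_gt0 n : 0 < offdiag n.
Proof. by rewrite sqrtr_gt0 mulr_gt0 ?addr_gt0. Qed.

Lemma offdiag_le n : offdiag n <= n.+1%:R + alpha.
Proof.
have h := ltW (succ_gt0 n); have al0 := ltW alpha_gt0.
rewrite -ler_sqr ?nnegrE ?(ltW (offdiag_gt0 n))// ?addr_ge0//.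
rewrite offdiag_sqr expr2 ler_wpM2r ?addr_ge0// lerDl//.
Qed.

Lemma edge_ge0 a n : 0 <= edge a n.
Proof.
rewrite /edge [X in X - _]addrC; apply: quadratic_form_ge0.
  by rewrite addr_gt0.
by rewrite offdiag_sqr mulrC.
Qed.

Lemma energy_ge0 m M a : 0 <= energy m M a.
Proof.
apply: addr_ge0; last by rewrite mulr_ge0 ?sqr_ge0// ltW.
by apply: sumr_ge0 => n _; exact: edge_ge0.
Qed.

(** The increment is the square of sqrt(n+1+alpha) a(n+1) - sqrt(n+1) a(n), with
n = M: stopping at M uses the cheapest continuation, so a longer prescribed
piece costs more. *)
Lemma energy_le m M a : (m <= M)%N -> energy m M a <= energy m M.+1 a.
Proof.
move=> mM; rewrite /energy big_nat_recr//= -addrA lerD2l -subr_ge0 /edge.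
set x := a M; set y := a M.+1; set b := offdiag M; set k : R := M.+1%:R.
have -> : k * y ^+ 2 + (k + alpha) * x ^+ 2 - 2 * b * x * y + alpha * y ^+ 2
   - alpha * x ^+ 2 = k * x ^+ 2 + (k + alpha) * y ^+ 2 - 2 * b * x * y by ring.
by apply: quadratic_form_ge0; rewrite ?offdiag_sqr// /k ltr0Sn.
Qed.

Lemma energy_mono m M N a : (m <= M <= N)%N -> energy m M a <= energy m N a.
Proof.
move=> /andP[mM]; elim: N => [|N IH]; first by rewrite leqn0 => /eqP<-.
rewrite leq_eqVlt => /orP[/eqP->//|]; rewrite ltnS => MN.
by apply: (le_trans (IH MN)); apply: energy_le; apply: leq_trans MN.
Qed.

(** Stop at n: the energy already contains the cost alpha a(n)^2 of going from n to
infinity. *)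
Lemma pointwise_energy m n M a :
  (m <= n <= M)%N -> alpha * a n ^+ 2 <= energy m M a.
Proof.
move=> mnM; apply: le_trans (energy_mono a mnM).
by rewrite lerDr sumr_ge0// => k _; exact: edge_ge0.
Qed.

(** The largest constant for which the determinant in [hardy_step] is nonnegative
at n = 0. *)
Definition hardy_cst : R := alpha ^+ 2 / (2 * (alpha + 2)).

Lemma hardy_cst_gt0 : 0 < hardy_cst.
Proof. by rewrite divr_gt0 ?exprn_gt0// mulr_gt0// addr_gt0. Qed.

(** Only half of the boundary term alpha a(n)^2 is used in the telescoping, which
leaves room for the Hardy weight. *)
Lemma hardy_step a n :
  alpha / 2 * a n ^+ 2 + hardy_cst * (a n ^+ 2 / n.+1%:R)
  <= edge a n + alpha / 2 * a n.+1 ^+ 2.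
Proof.
rewrite -subr_ge0 /edge.
set x := a n; set y := a n.+1; set b := offdiag n; set k : R := n.+1%:R.
have k1 : 1 <= k by rewrite /k ler1n.
have k0 : 0 < k by apply: lt_le_trans k1.
have -> : k * y ^+ 2 + (k + alpha) * x ^+ 2 - 2 * b * x * y
    + alpha / 2 * y ^+ 2 - (alpha / 2 * x ^+ 2 + hardy_cst * (x ^+ 2 / k))
  = (k + alpha / 2) * y ^+ 2 + (k + alpha / 2 - hardy_cst / k) * x ^+ 2
    - 2 * b * y * x by field; rewrite gt_eqF.
apply: quadratic_form_ge0; first by rewrite addr_gt0// divr_gt0.
rewrite offdiag_sqr -/k -subr_ge0.
have -> : (k + alpha / 2) * (k + alpha / 2 - hardy_cst / k) - k * (k + alpha)
  = alpha ^+ 3 / (4 * (alpha + 2)) * (1 - k^-1).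
  rewrite /hardy_cst; field.
  by rewrite !gt_eqF// addr_gt0.
rewrite mulr_ge0//.
  by rewrite divr_ge0 ?exprn_ge0 ?mulr_ge0 ?addr_ge0 ?(ltW alpha_gt0).
by rewrite subr_ge0 invf_le1.
Qed.

Lemma hardy m M a : (m <= M)%N ->
  hardy_cst * \sum_(m <= n < M.+1) a n ^+ 2 / n.+1%:R <= energy m M a.
Proof.
move=> mM; have al0 := alpha_gt0.
have telescoped : alpha / 2 * a m ^+ 2
    + hardy_cst * \sum_(m <= n < M) a n ^+ 2 / n.+1%:R
    <= \sum_(m <= n < M) edge a n + alpha / 2 * a M ^+ 2.
  elim: M mM => [|M IH].
    by rewrite leqn0 => /eqP->; rewrite !big_geq// mulr0 add0r addr0.
  rewrite leq_eqVlt => /orP[/eqP->|]; first by rewrite !big_geq// mulr0 add0r addr0.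
  rewrite ltnS => mM; rewrite !big_nat_recr//= mulrDr.
  move: (IH mM) (hardy_step a M).
  move: (edge a M) (hardy_cst * (_ / _)) => e h; lra.
have last : hardy_cst * (a M ^+ 2 / M.+1%:R) <= alpha / 2 * a M ^+ 2.
  rewrite mulrCA mulrC ler_wpM2r ?sqr_ge0//.
  apply: (@le_trans _ _ hardy_cst).
    by rewrite ler_pdivrMr// ler_peMr ?ler1n// ltW// hardy_cst_gt0.
  rewrite /hardy_cst ler_pdivrMr; last by lra.
  by nra.
rewrite big_nat_recr//= mulrDr /energy.
have : 0 <= alpha / 2 * a m ^+ 2 by rewrite mulr_ge0 ?sqr_ge0//; lra.
move: last telescoped; move: (hardy_cst * (_ / _)) => h; lra.
Qed.

Lemma sigma2_0 : sigma2 alpha 0 = 1.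
Proof. by rewrite /sigma2 /pochhammer big_ord0 fact0 divr1. Qed.

Lemma sigma2S n : sigma2 alpha n.+1 = sigma2 alpha n * (1 + alpha / n.+1%:R).
Proof.
rewrite /sigma2 /pochhammer big_ord_recr/= factS natrM.
have := succ_gt0 n; have : 0 < n`!%:R :> R by rewrite ltr0n fact_gt0.
rewrite -[in X in _ -> _ -> X]natr1 => h1 h2; field.
by rewrite !gt_eqF.
Qed.

Lemma sigma2_gt0 n : 0 < sigma2 alpha n.
Proof.
elim: n => [|n IH]; first by rewrite sigma2_0.
by rewrite sigma2S mulr_gt0// addr_gt0// divr_gt0.
Qed.

Lemma sigma2_ge1 n : 1 <= sigma2 alpha n.
Proof.
elim: n => [|n IH]; first by rewrite sigma2_0.
by rewrite sigma2S mulr_ege1// lerDl divr_ge0// ltW.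
Qed.

(** sigma(n)^2 is the product of the 1 + alpha / i, i <= n, which grows like n^alpha.
An integer k >= alpha shifts the index so that each factor dominates
(1 + 1/(i+k))^alpha. *)
Lemma sigma2_growth : exists2 c : R, 0 < c &
  forall n, n.+1%:R `^ alpha <= c * sigma2 alpha n.
Proof.
have al0 := alpha_gt0.
pose k := (Num.trunc alpha).+1.
have ka : alpha < k%:R by apply: truncnS_gt.
exists (k.+1%:R `^ alpha); first by rewrite powR_gt0// ltr0n.
move=> n; apply: (@le_trans _ _ ((n + k.+1)%:R `^ alpha)).
  by rewrite ge0_ler_powR ?nnegrE ?(ltW al0)// ler_nat addnS ltnS leq_addr.
elim: n => [|n IH]; first by rewrite sigma2_0 mulr1.
rewrite sigma2S mulrA.
have j0 : 0 < (n + k.+1)%:R :> R by rewrite ltr0n addnS.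
pose x : R := 1 + (n + k.+1)%:R^-1.
have x0 : 0 < x by rewrite addr_gt0// invr_gt0.
have -> : (n.+1 + k.+1)%:R = (n + k.+1)%:R * x.
  by rewrite /x mulrDr mulr1 mulfV ?gt_eqF// natr1.
rewrite powRM ?(ltW j0) ?(ltW x0)//.
apply: ler_pM => //; rewrite ?powR_ge0//.
(* 1 + 1/j <= exp (1/j), and exp (-t) >= 1 - t with t = alpha / j < 1. *)
apply: (@le_trans _ _ (expR (alpha / (n + k.+1)%:R))).
  rewrite /powR gt_eqF// ler_expR ler_wpM2l ?(ltW al0)//.
  by apply: le_ln1Dx; apply: lt_trans (_ : 0 < _); rewrite ?ltrN10// invr_gt0.
set t := alpha / _.
have t1 : 0 < 1 - t.
  rewrite subr_gt0 ltr_pdivrMr// mul1r (lt_le_trans ka)// ler_nat.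
  by rewrite addnS -addSn leq_addl.
have : expR t <= (1 - t)^-1.
  by rewrite -[expR t]invrK lef_pV2 ?posrE ?invr_gt0 ?expR_gt0// -expRN expR_ge1Dx.
move=> /le_trans; apply; rewrite -div1r ler_pdivrMr//.
have n0 := succ_gt0 n.
have nj : n.+1%:R + alpha <= (n + k.+1)%:R.
  by rewrite addnS -addSn natrD lerD2l ltW.
rewrite -subr_ge0 /t.
have -> : (1 + alpha / n.+1%:R) * (1 - alpha / (n + k.+1)%:R) - 1 =
  alpha / n.+1%:R / (n + k.+1)%:R * ((n + k.+1)%:R - (n.+1%:R + alpha)).
  by field; rewrite !gt_eqF.
by rewrite mulr_ge0 ?subr_ge0// !divr_ge0 ?ltW.
Qed.

End EnergyInequalities.

(** * Potentials of small weight and Dirichlet points *)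

Section DirichletPoints.
Variables (R : realType) (alpha : R).
Hypothesis alpha_gt0 : 0 < alpha.
Implicit Types (a q : nat -> R) (n m M : nat).

(** Interpolation between the two energy bounds: either x <= s, or the factor
(x/s)^alpha is at least 1. *)
Lemma truncation_le (x s : R) : 0 <= x -> 0 < s ->
  x <= s + x `^ (1 + alpha) / s `^ alpha.
Proof.
move=> x0 s0; case: (leP x s) => [xs|sx].
  by rewrite -[x]addr0 lerD// divr_ge0 ?powR_ge0.
have {}x0 : 0 < x by apply: lt_trans sx.
apply: (@le_trans _ _ (x `^ (1 + alpha) / s `^ alpha)); last first.
  by rewrite lerDr ltW.
rewrite powRD; last by rewrite (gt_eqF x0) implybT.
rewrite powRr1 ?(ltW x0)// -mulrA ler_peMr ?(ltW x0)// ler_pdivlMr ?powR_gt0// mul1r.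
by rewrite ge0_ler_powR ?nnegrE ?ltW.
Qed.

(** With s = kap / (n+1), the part s of the potential costs half of the energy by the
Hardy inequality; the rest is at most a constant times
q^(1+alpha) sigma^2 a^2 and costs the other half by the pointwise bound when
eps is small. *)
Lemma sobolev_block : exists2 eps : R, 0 < eps &
  forall q m M a, (forall n, 0 <= q n) -> (m <= M)%N ->
    \sum_(m <= n < M.+1) q n `^ (1 + alpha) * sigma2 alpha n <= eps ->
    \sum_(m <= n < M.+1) q n * a n ^+ 2 <= energy alpha m M a.
Proof.
have [c c0 growth] := sigma2_growth alpha_gt0.
have th0 := hardy_cst_gt0 alpha_gt0.
pose kap := hardy_cst alpha / 2.
have kap0 : 0 < kap by rewrite divr_gt0.
have K0 : 0 < kap `^ alpha by rewrite powR_gt0.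
exists (kap `^ alpha * alpha / (2 * c)).
  by rewrite divr_gt0 ?mulr_gt0.
move=> q m M a q0 mM small; set E := energy _ _ _ _.
have E0 : 0 <= E by exact: energy_ge0.
apply: (@le_trans _ _ (\sum_(m <= n < M.+1)
   (kap * (a n ^+ 2 / n.+1%:R) + c / kap `^ alpha / alpha * E *
      (q n `^ (1 + alpha) * sigma2 alpha n)))).
  rewrite big_nat_cond [leRHS]big_nat_cond.
  apply: ler_sum => n; rewrite andbT ltnS => mnM.
  have s0 : 0 < kap / n.+1%:R by rewrite divr_gt0.
  have := ler_wpM2r (sqr_ge0 (a n)) (truncation_le (q0 n) s0).
  move=> /le_trans; apply; rewrite mulrDl lerD//.
    by rewrite mulrA -[_ / _ * _]mulrAC.
  set s := kap / _ in s0 *.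
  have -> : kap = n.+1%:R * s by rewrite /s mulrC divfK// gt_eqF.
  have sa0 : 0 < s `^ alpha by rewrite powR_gt0.
  have na0 : 0 < n.+1%:R `^ alpha :> R by rewrite powR_gt0.
  rewrite powRM ?(ltW s0)//.
  have -> : c / (n.+1%:R `^ alpha * s `^ alpha) / alpha * E *
      (q n `^ (1 + alpha) * sigma2 alpha n) = q n `^ (1 + alpha) / s `^ alpha *
      ((c * sigma2 alpha n) / n.+1%:R `^ alpha * (E / alpha)).
    by field; rewrite !gt_eqF.
  rewrite ler_wpM2l ?divr_ge0 ?powR_ge0//.
  have aE : a n ^+ 2 <= E / alpha.
    by rewrite ler_pdivlMr// mulrC pointwise_energy.
  apply: (le_trans aE); rewrite ler_peMl ?divr_ge0 ?(ltW alpha_gt0)//.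
  by rewrite ler_pdivlMr// mul1r.
rewrite big_split/= -!mulr_sumr.
have hE : kap * \sum_(m <= n < M.+1) a n ^+ 2 / n.+1%:R <= E / 2.
  by rewrite /kap mulrAC ler_pM2r ?invr_gt0// hardy.
have cE : 0 <= c / kap `^ alpha / alpha * E.
  by rewrite mulr_ge0// !divr_ge0 ?(ltW c0) ?(ltW K0) ?(ltW alpha_gt0).
have := ler_wpM2l cE small.
have -> : c / kap `^ alpha / alpha * E * (kap `^ alpha * alpha / (2 * c)) = E / 2.
  by field; rewrite !gt_eqF.
by move: hE; lra.
Qed.

(** The pair (Z, m) records a cutting of [0, m[ into finished blocks.  Each new
point, put where the weight accumulated since m first exceeds eps, makes the
block on its left harmless, because a vanishes at its right end.  The size of Z
is bounded by S / eps, so a cutting of maximal size exists, and after it the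
remaining weight never exceeds eps. *)
Lemma dirichlet_points : exists2 eps : R, 0 < eps &
  forall q (S : R), (forall n, 0 <= q n) ->
    (forall M, \sum_(0 <= n < M) q n `^ (1 + alpha) * sigma2 alpha n <= S) ->
    exists (Z : seq nat) (m : nat), (size Z)%:R * eps <= S /\
      forall a, (forall n, n \in Z -> a n = 0) -> forall M, (m <= M)%N ->
        \sum_(0 <= n < M.+1) q n * a n ^+ 2 <= energy alpha 0 M a.
Proof.
have [eps eps0 block] := sobolev_block; exists eps => // q S q0 qS.
pose g n := q n `^ (1 + alpha) * sigma2 alpha n.
have g0 n : 0 <= g n by rewrite mulr_ge0 ?powR_ge0// ltW// sigma2_gt0.
pose good (Z : seq nat) (m : nat) :=
  (size Z)%:R * eps <= \sum_(0 <= n < m) g n /\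
  forall a, (forall n, n \in Z -> a n = 0) ->
    \sum_(0 <= n < m) q n * a n ^+ 2 <= \sum_(0 <= n < m) edge alpha a n.
have good0 : good [::] 0%N.
  by split=> [|a _]; rewrite !big_geq// mul0r.
have good_extend Z m : good Z m -> forall M, (m <= M)%N ->
    \sum_(m <= n < M) g n <= eps -> eps < \sum_(m <= n < M.+1) g n ->
    good (M :: Z) M.+1.
  move=> [sZ vZ] M mM le_eps gt_eps; split=> [|a aZ].
    rewrite (big_cat_nat (n := m))//=; last by apply: leq_trans mM _.
    by rewrite -natr1 mulrDl mul1r lerD// ltW.
  have aM : a M = 0 by apply: aZ; rewrite mem_head.
  have aZ' n : n \in Z -> a n = 0 by move=> nZ; apply: aZ; rewrite inE nZ orbT.
  have mM1 : (m <= M.+1)%N by apply: leq_trans mM _.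
  rewrite (big_cat_nat (n := m))//= [leRHS](big_cat_nat (n := m))//=.
  apply: lerD; first exact: vZ.
  rewrite !big_nat_recr//= aM expr0n/= mulr0 addr0.
  apply: (@le_trans _ _ (\sum_(m <= n < M) edge alpha a n)); last first.
    by rewrite lerDl edge_ge0.
  case: M mM le_eps {gt_eps aZ mM1} aM => [|M] mM le_eps aM.
    by move: mM; rewrite leqn0 => /eqP->; rewrite !big_geq.
  move: mM; rewrite leq_eqVlt => /orP[/eqP->|]; first by rewrite !big_geq.
  rewrite ltnS => mM.
  apply: le_trans (block q m M a q0 mM le_eps) _.
  apply: le_trans (energy_le alpha_gt0 a mM) _.
  by rewrite /energy aM expr0n/= mulr0 addr0.
have bounded Z m : good Z m -> (size Z)%:R * eps <= S.
  by case=> h _; apply: le_trans h (qS m).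
pose size_ok k := `[< exists Z m, good Z m /\ size Z = k >].
have ex_ok : exists k, size_ok k by exists 0%N; apply/asboolP; exists [::], 0%N.
have ok_bound k : size_ok k -> (k <= Num.trunc (S / eps))%N.
  move=> /asboolP[Z [m [h <-]]]; rewrite -ltnS -(ltr_nat R).
  apply: le_lt_trans (truncnS_gt _).
  by rewrite ler_pdivlMr// (bounded _ _ h).
have [k /asboolP[Z [m [gZ sizeZ]]] maxk] := ex_maxnP ex_ok ok_bound.
exists Z, m; split=> [|a aZ M mM]; first exact: bounded gZ.
have tail N : (m <= N)%N -> \sum_(m <= n < N) g n <= eps.
  elim: N => [|N IH]; first by rewrite leqn0 => /eqP->; rewrite big_geq// ltW.
  rewrite leq_eqVlt => /orP[/eqP->|]; first by rewrite big_geq// ltW.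
  rewrite ltnS => mN; rewrite leNgt; apply/negP => big.
  have gZ' := good_extend _ _ gZ _ mN (IH mN) big.
  suff : (k.+1 <= k)%N by rewrite ltnn.
  by apply: maxk; apply/asboolP; exists (N :: Z), N.+1; split=> //=; rewrite sizeZ.
have mM1 : (m <= M.+1)%N by apply: leq_trans mM _.
rewrite (big_cat_nat (n := m))//= /energy (big_cat_nat (n := m) (F := edge _ _))//=.
rewrite -addrA; apply: lerD; first by case: gZ => _; apply.
by apply: block => //; apply: tail.
Qed.

End DirichletPoints.

(** * Square-summable complex sequences *)

Section SequenceSpace.
Variable R : realType.
Local Open Scope classical_set_scope.
Local Open Scope complex_scope.
Implicit Types (u w y : cseq R) (z c : R[i]) (n M : nat).

Lemma sqnormc_ge0 z : 0 <= sqnormc z.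
Proof. by rewrite addr_ge0 ?sqr_ge0. Qed.

Lemma sqnormc_eq0 z : sqnormc z = 0 -> z = 0.
Proof.
case: z => x y; rewrite /sqnormc/= => /eqP.
by rewrite paddr_eq0 ?sqr_ge0// !sqrf_eq0 => /andP[/eqP-> /eqP->].
Qed.

Lemma sqnormcM c z : sqnormc (c * z) = sqnormc c * sqnormc z.
Proof. by case: c z => [a b] [x y]; rewrite /sqnormc/=; ring. Qed.

Lemma sqnormcD_le c z : sqnormc (c + z) <= 2 * sqnormc c + 2 * sqnormc z.
Proof.
case: c z => [a b] [x y]; rewrite /sqnormc/=.
by have := sqr_ge0 (a - x); have := sqr_ge0 (b - y); rewrite !expr2; lra.
Qed.

Lemma Re_mul_conj z c : complex.Re (z * c^*) =
  complex.Re z * complex.Re c + complex.Im z * complex.Im c.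
Proof. by case: z c => [a b] [x y] /=; ring. Qed.

Lemma Im_mul_conj z c : complex.Im (z * c^*) =
  complex.Im z * complex.Re c - complex.Re z * complex.Im c.
Proof. by case: z c => [a b] [x y] /=; ring. Qed.

Lemma Re_mul_conj_le z c : `|complex.Re (z * c^*)| <= sqnormc z + sqnormc c.
Proof.
rewrite Re_mul_conj /sqnormc; case: z c => [a b] [x y] /=.
have := (sqr_ge0 (a - x), sqr_ge0 (b - y), sqr_ge0 (a + x), sqr_ge0 (b + y)).
have := (sqr_ge0 a, sqr_ge0 b, sqr_ge0 x, sqr_ge0 y).
by rewrite !expr2 ler_norml => -[[[? ?] ?] ?] [[[? ?] ?] ?]; apply/andP; split; lra.
Qed.

Lemma Im_mul_conj_le z c : `|complex.Im (z * c^*)| <= sqnormc z + sqnormc c.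
Proof.
rewrite Im_mul_conj /sqnormc; case: z c => [a b] [x y] /=.
have := (sqr_ge0 (b - x), sqr_ge0 (a - y), sqr_ge0 (b + x), sqr_ge0 (a + y)).
have := (sqr_ge0 a, sqr_ge0 b, sqr_ge0 x, sqr_ge0 y).
by rewrite !expr2 ler_norml => -[[[? ?] ?] ?] [[[? ?] ?] ?]; apply/andP; split; lra.
Qed.

Lemma bounded_sums_cvg (x : nat -> R) (B : R) : (forall n, 0 <= x n) ->
  (forall M, \sum_(0 <= n < M) x n <= B) -> cvgn (series x).
Proof.
move=> x0 xB; apply: nondecreasing_is_cvgn.
  by apply/nondecreasing_seqP => n; rewrite /series/= big_nat_recr//= lerDl.
by exists B => _ [n _ <-]; apply: xB.
Qed.

Lemma sum_le_limn (x : nat -> R) M : (forall n, 0 <= x n) ->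
  cvgn (series x) -> \sum_(0 <= n < M) x n <= limn (series x).
Proof.
move=> x0 cx; apply: (nondecreasing_cvgn_le (u_ := series x)) => //.
by apply/nondecreasing_seqP => n; rewrite /series/= big_nat_recr//= lerDl.
Qed.

Lemma nneseries_lt_pinftyP (x : nat -> R) : (forall n, 0 <= x n) ->
  ((\sum_(0 <= n <oo) (x n)%:E < +oo)%E <-> cvgn (series x)).
Proof.
move=> x0; have e0 n : (0 <= (x n)%:E)%E by rewrite lee_fin.
split=> [fin|cx].
  apply: (@bounded_sums_cvg _ (fine (\sum_(0 <= n <oo) (x n)%:E)%E)) => // M.
  rewrite -lee_fin fineK ?ge0_fin_numE//; last exact: nneseries_ge0.
  by rewrite -sumEFin; apply: nneseries_lim_ge.
suff -> : (\sum_(0 <= n <oo) (x n)%:E = (limn (series x))%:E)%E by rewrite ltry.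
apply/cvg_lim => //; under eq_cvg do rewrite sumEFin.
by apply: cvg_EFin => //; exact: nearW.
Qed.

Lemma nneseries_limn (x : nat -> R) : (forall n, 0 <= x n) -> cvgn (series x) ->
  (\sum_(0 <= n <oo) (x n)%:E = (limn (series x))%:E)%E.
Proof.
move=> x0 cx; apply/cvg_lim => //; under eq_cvg do rewrite sumEFin.
by apply: cvg_EFin => //; exact: nearW.
Qed.

Definition sqnorm u : R := limn (series (fun n => sqnormc (u n))).

Lemma l2_cvg u : l2 u <-> cvgn (series (fun n => sqnormc (u n))).
Proof. by apply: nneseries_lt_pinftyP => n; exact: sqnormc_ge0. Qed.

Lemma l2_bounded u B : (forall M, \sum_(0 <= n < M) sqnormc (u n) <= B) -> l2 u.
Proof.
by move=> uB; apply/l2_cvg; apply: bounded_sums_cvg uB => n; exact: sqnormc_ge0.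
Qed.

Lemma sum_le_sqnorm u M : l2 u -> \sum_(0 <= n < M) sqnormc (u n) <= sqnorm u.
Proof. by move=> /l2_cvg; apply: sum_le_limn => n; exact: sqnormc_ge0. Qed.

Lemma sqnorm_le u B : (forall M, \sum_(0 <= n < M) sqnormc (u n) <= B) ->
  sqnorm u <= B.
Proof.
move=> uB; have /l2_cvg cu := l2_bounded uB.
by apply: limr_le => //; apply: nearW => M; exact: uB.
Qed.

Lemma sqnorm_ge0 u : l2 u -> 0 <= sqnorm u.
Proof. by move=> /(sum_le_sqnorm 0); rewrite big_geq. Qed.

Lemma term_le_sqnorm u n : l2 u -> sqnormc (u n) <= sqnorm u.
Proof.
move=> /(sum_le_sqnorm n.+1); apply: le_trans; rewrite big_nat_recr//= lerDr.
by apply: sumr_ge0 => k _; exact: sqnormc_ge0.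
Qed.

Lemma sqnorm_eq0 u : l2 u -> sqnorm u <= 0 -> forall n, u n = 0.
Proof.
move=> lu u0 n; apply: sqnormc_eq0; apply/eqP; rewrite eq_le sqnormc_ge0 andbT.
exact: le_trans (term_le_sqnorm n lu) u0.
Qed.

Lemma l2_linear_bound c u w M : l2 u -> l2 w ->
  \sum_(0 <= n < M) sqnormc (c * u n + w n) <=
  2 * sqnormc c * sqnorm u + 2 * sqnorm w.
Proof.
move=> lu lw; apply: (@le_trans _ _ (\sum_(0 <= n < M)
    (2 * sqnormc c * sqnormc (u n) + 2 * sqnormc (w n)))).
  by apply: ler_sum => n _; rewrite -mulrA -sqnormcM sqnormcD_le.
rewrite big_split/= -!mulr_sumr lerD// ler_wpM2l ?mulr_ge0 ?sqnormc_ge0//;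
exact: sum_le_sqnorm.
Qed.

Lemma l2_linear c u w : l2 u -> l2 w -> l2 (fun n => c * u n + w n).
Proof. by move=> lu lw; apply: l2_bounded => M; exact: l2_linear_bound. Qed.

Lemma sqnorm_linear_le c u w : l2 u -> l2 w ->
  sqnorm (fun n => c * u n + w n) <= 2 * sqnormc c * sqnorm u + 2 * sqnorm w.
Proof. by move=> lu lw; apply: sqnorm_le => M; exact: l2_linear_bound. Qed.

Lemma l2_0 : l2 (fun _ => 0 : R[i]).
Proof.
apply: (@l2_bounded _ 0) => M; rewrite big1// => n _.
by rewrite /sqnormc/= expr0n addr0.
Qed.

Lemma l2_sum (k : nat) (c : 'I_k -> R[i]) (f : 'I_k -> cseq R) :
  (forall i, l2 (f i)) -> l2 (fun n => \sum_(i < k) c i * f i n).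
Proof.
elim: k c f => [|k IH] c f lf.
  by under eq_fun do rewrite big_ord0; exact: l2_0.
under eq_fun do rewrite big_ord_recl.
by apply: l2_linear => //; apply: IH => i; exact: lf.
Qed.

Definition ccvg (f : cseq R) (l : R[i]) : Prop :=
  series (fun n => complex.Re (f n)) @ \oo --> complex.Re l /\
  series (fun n => complex.Im (f n)) @ \oo --> complex.Im l.

Lemma ccvg_csum f l : ccvg f l -> csum f = l.
Proof. by case: l => a b [/= ? ?]; congr (_ +i* _); apply: cvg_lim. Qed.

Lemma ccvg_linear c f g l l' : ccvg f l -> ccvg g l' ->
  ccvg (fun n => c * f n + g n) (c * l + l').
Proof.
case: c l l' => [a b] [x y] [x' y'] [/= fx fy] [/= gx gy]; split=> /=.
  have -> : series (fun n => complex.Re ((a +i* b) * f n + g n)) =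
    (fun M => a * series (fun n => complex.Re (f n)) M
            - b * series (fun n => complex.Im (f n)) M
            + series (fun n => complex.Re (g n)) M).
    apply/funext => M; rewrite /series/= !mulr_sumr -sumrB -big_split/=.
    by apply: eq_bigr => n _; case: (f n) (g n) => [? ?] [? ?].
  by apply: cvgD => //; apply: cvgB; apply: cvgMr.
have -> : series (fun n => complex.Im ((a +i* b) * f n + g n)) =
  (fun M => a * series (fun n => complex.Im (f n)) M
          + b * series (fun n => complex.Re (f n)) M
          + series (fun n => complex.Im (g n)) M).
  apply/funext => M; rewrite /series/= !mulr_sumr -!big_split/=.
  by apply: eq_bigr => n _; case: (f n) (g n) => [? ?] [? ?].
by apply: cvgD => //; apply: cvgD; apply: cvgMr.
Qed.

Lemma ccvg_inner u w : l2 u -> l2 w -> ccvg (fun n => u n * (w n)^*) (inner u w).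
Proof.
move=> lu lw; have /l2_cvg cu := lu; have /l2_cvg cw := lw.
have cuw : cvgn (series (fun n => sqnormc (u n) + sqnormc (w n))).
  exact: is_cvg_seriesD.
have sq0 n : 0 <= sqnormc (u n) + sqnormc (w n) by rewrite addr_ge0 ?sqnormc_ge0.
split; apply: normed_cvg; apply: (series_le_cvg _ sq0 _ cuw) => n //=.
- exact: Re_mul_conj_le.
- exact: Im_mul_conj_le.
Qed.

Lemma inner_linear c u w y : l2 u -> l2 w -> l2 y ->
  inner (fun n => c * u n + w n) y = c * inner u y + inner w y.
Proof.
move=> lu lw ly; apply: ccvg_csum.
under [X in ccvg X]eq_fun do rewrite mulrDl -mulrA.
by apply: ccvg_linear; exact: ccvg_inner.
Qed.

Lemma inner_conj u w : l2 u -> l2 w -> inner w u = (inner u w)^*.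
Proof.
move=> lu lw; apply: ccvg_csum; have := ccvg_inner lu lw.
case: (inner u w) => x y [/= h1 h2]; split=> /=.
  rewrite (_ : series _ = series (fun n => complex.Re (u n * (w n)^*)))//.
  by congr series; apply/funext => n; rewrite !Re_mul_conj; ring.
rewrite (_ : series _ = - series (fun n => complex.Im (u n * (w n)^*))).
  exact: cvgN.
apply/funext => M; rewrite fctE /series/= -sumrN; apply: eq_bigr => n _.
by rewrite !Im_mul_conj; ring.
Qed.

Lemma inner_self u : l2 u -> inner u u = (sqnorm u)%:C.
Proof.
move=> lu; apply: ccvg_csum; split=> /=.
  have /l2_cvg cu := lu.
  rewrite (_ : series _ = series (fun n => sqnormc (u n)))//.
  by congr series; apply/funext => n; rewrite Re_mul_conj /sqnormc !expr2.
rewrite (_ : series _ = fun _ => 0); first exact: cvg_cst.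
apply/funext => M; rewrite /series/= big1// => n _.
by rewrite Im_mul_conj; ring.
Qed.

Lemma inner_sum (k : nat) (c : 'I_k -> R[i]) (f : 'I_k -> cseq R) y :
  (forall i, l2 (f i)) -> l2 y ->
  inner (fun n => \sum_(i < k) c i * f i n) y = \sum_(i < k) c i * inner (f i) y.
Proof.
move=> + ly; elim: k c f => [|k IH] c f lf.
  rewrite big_ord0; apply: ccvg_csum; split=> /=.
    rewrite (_ : series _ = fun _ => 0); first exact: cvg_cst.
    by apply/funext => M; rewrite /series/= big1// => n _; rewrite big_ord0 mul0r.
  rewrite (_ : series _ = fun _ => 0); first exact: cvg_cst.
  by apply/funext => M; rewrite /series/= big1// => n _; rewrite big_ord0 mul0r.
rewrite big_ord_recl -IH// -inner_linear//; last by apply: l2_sum.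
by congr inner; apply/funext => n; rewrite big_ord_recl.
Qed.

End SequenceSpace.

(** * The quadratic form on the maximal domain *)

Section LaguerreForm.
Variables (R : realType) (alpha : R).
Hypothesis alpha_gt0 : 0 < alpha.
Local Open Scope classical_set_scope.
Local Open Scope complex_scope.
Implicit Types (u w : cseq R) (z : R[i]) (v : nat -> R) (n M : nat).

Local Notation b := (offdiag alpha).

Definition re_seq u n : R := complex.Re (u n).
Definition im_seq u n : R := complex.Im (u n).

Definition cenergy M u : R :=
  energy alpha 0 M (re_seq u) + energy alpha 0 M (im_seq u).

Lemma tau0 u : tau alpha u 0 = (1 + alpha)%:C * u 0%N - (b 0)%:C * u 1%N.
Proof. by rewrite /tau mulr0 mul0rn !add0r. Qed.

Lemma tauS u n : tau alpha u n.+1 =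
  - (b n)%:C * u n + (n.+1%:R *+ 2 + 1 + alpha)%:C * u n.+1 - (b n.+1)%:C * u n.+2.
Proof. by []. Qed.

(** Summation by parts; the edge energies appear because
n + (n+1+alpha) = 2n+1+alpha. *)
Lemma green_re u M : \sum_(0 <= n < M.+1) complex.Re (tau alpha u n * (u n)^*) =
  cenergy M u + M.+1%:R * sqnormc (u M) - b M * complex.Re (u M.+1 * (u M)^*).
Proof.
rewrite /cenergy /energy; elim: M => [|M IH].
  rewrite big_nat1 !(big_geq (leqnn 0)) tau0 /re_seq /im_seq /sqnormc.
  by case: (u 0%N) (u 1%N) => [x y] [x' y'] /=; ring.
rewrite big_nat_recr//= {}IH 2?[in RHS]big_nat_recr//= tauS /edge.
rewrite /re_seq /im_seq /sqnormc -[M.+2%:R]natr1.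
by case: (u M) (u M.+1) (u M.+2) => [x y] [x' y'] [x'' y''] /=; ring.
Qed.

Lemma green_im u M : \sum_(0 <= n < M.+1) complex.Im (tau alpha u n * (u n)^*) =
  - b M * complex.Im (u M.+1 * (u M)^*).
Proof.
elim: M => [|M IH].
  rewrite big_nat1 tau0.
  by case: (u 0%N) (u 1%N) => [x y] [x' y'] /=; ring.
rewrite big_nat_recr//= {}IH tauS.
by case: (u M) (u M.+1) (u M.+2) => [x y] [x' y'] [x'' y''] /=; ring.
Qed.

Local Notation H v := (laguerre alpha v).

Lemma form_re v u M : \sum_(0 <= n < M.+1) complex.Re (act (H v) u n * (u n)^*) =
  cenergy M u + M.+1%:R * sqnormc (u M) - b M * complex.Re (u M.+1 * (u M)^*)
  - \sum_(0 <= n < M.+1) v n * sqnormc (u n).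
Proof.
rewrite -green_re -sumrB; apply: eq_bigr => n _ /=.
by rewrite /sqnormc; case: (tau alpha u n) (u n) => [x y] [x' y'] /=; ring.
Qed.

Lemma form_im v u M : \sum_(0 <= n < M.+1) complex.Im (act (H v) u n * (u n)^*) =
  - b M * complex.Im (u M.+1 * (u M)^*).
Proof.
rewrite -green_im; apply: eq_bigr => n _ /=.
by case: (tau alpha u n) (u n) => [x y] [x' y'] /=; ring.
Qed.

(** Otherwise x M > eta / (M+1) from some point on, and the harmonic series would
converge. *)
Lemma frequently_small (x : nat -> R) : (forall n, 0 <= x n) ->
  cvgn (series x) -> forall eta N, 0 < eta ->
  exists2 M, (N <= M)%N & M.+1%:R * x M <= eta.
Proof.
move=> x0 cx eta N eta0; apply: contrapT => nex.
apply: (@dvg_harmonic R).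
have big M : (N <= M)%N -> eta * harmonic M <= x M.
  move=> NM; rewrite ler_pdivrMr// leNgt; apply/negP => lt_eta.
  by apply: nex; exists M => //; rewrite mulrC ltW.
apply: (@bounded_sums_cvg _ _ (\sum_(0 <= n < N) harmonic n + limn (series x) / eta)).
  by move=> n; exact: harmonic_ge0.
move=> M; have [MN|NM] := leqP M N.
  apply: (@le_trans _ _ (\sum_(0 <= n < N) harmonic n)).
    rewrite [leRHS](big_cat_nat (n := M))//= lerDl.
    by apply: sumr_ge0 => n _; exact: harmonic_ge0.
  rewrite lerDl divr_ge0 ?(ltW eta0)//.
  by have := sum_le_limn 0 x0 cx; rewrite big_geq.
rewrite (big_cat_nat (n := N))//= ?(ltnW NM)// lerD2l ler_pdivlMr// mulrC mulr_sumr.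
apply: (@le_trans _ _ (\sum_(N <= n < M) x n)).
  by rewrite big_nat_cond [leRHS]big_nat_cond; apply: ler_sum => n /andP[/andP[/big]].
apply: le_trans (sum_le_limn M x0 cx).
rewrite [leRHS](big_cat_nat (n := N))//= ?(ltnW NM)// lerDr.
by apply: sumr_ge0.
Qed.

Lemma frequently_ge0_lim (s : nat -> R) (l : R) : s @ \oo --> l ->
  (forall eta N, 0 < eta -> exists2 M, (N <= M)%N & - eta <= s M) -> 0 <= l.
Proof.
move=> sl freq; rewrite leNgt; apply/negP => l0.
have /(cvgrPdist_lt _ _).1 := sl => /(_ (- l / 2)).
have h0 : 0 < - l / 2 by rewrite divr_gt0// oppr_gt0.
move=> /(_ h0) [N _ near_l].
have [M NM] := freq _ N h0.
by have := near_l M NM; rewrite ltr_distl => /andP[+ _]; lra.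
Qed.

Lemma boundary_le (x : R) M X : `|x| <= X -> `|b M * x| <= (1 + alpha) * (M.+1%:R * X).
Proof.
move=> xX; rewrite normrM (gtr0_norm (offdiag_gt0 alpha_gt0 M)) mulrA.
apply: ler_pM => //; first exact: ltW (offdiag_gt0 alpha_gt0 M).
apply: (le_trans (offdiag_le alpha_gt0 M)).
by rewrite mulrDl mul1r lerD2l ler_peMr ?ler1n// ltW.
Qed.

Lemma frequently_small_boundary u : l2 u -> forall eta N, 0 < eta ->
  exists2 M, (N <= M)%N &
    forall x, `|x| <= sqnormc (u M.+1) + sqnormc (u M) -> `|b M * x| <= eta.
Proof.
move=> lu eta N eta0; have al0 : 0 < 1 + alpha by rewrite addr_gt0.
have /l2_cvg cu := lu.
have cx : cvgn (series (fun n => sqnormc (u n.+1) + sqnormc (u n))).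
  apply: (@bounded_sums_cvg _ _ (sqnorm u + sqnorm u)) => [n|M].
    by rewrite addr_ge0 ?sqnormc_ge0.
  rewrite big_split/= lerD ?sum_le_sqnorm//.
  apply: le_trans (sum_le_sqnorm M.+1 lu).
  by rewrite [leRHS]big_nat_recl//= lerDr sqnormc_ge0.
have x0 n : 0 <= sqnormc (u n.+1) + sqnormc (u n) by rewrite addr_ge0 ?sqnormc_ge0.
have [M NM hM] := frequently_small x0 cx N (divr_gt0 eta0 al0).
exists M => // x /boundary_le /le_trans; apply.
by rewrite mulrC -ler_pdivlMr.
Qed.

(** This is the symmetry of the maximal operator: the boundary term of the
summation by parts tends to 0 along a subsequence, while the partial sums
converge. *)
Lemma form_imaginary_part v u : dom (H v) u -> complex.Im (inner (act (H v) u) u) = 0.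
Proof.
move=> [lu lTu]; have [_ cv] := ccvg_inner lTu lu.
have cv1 := cv; rewrite -cvg_shiftS in cv1.
apply/eqP; rewrite eq_le; apply/andP; split.
  rewrite -oppr_ge0; apply: (frequently_ge0_lim (cvgN cv1)) => eta N eta0.
  have [M NM hM] := frequently_small_boundary lu N eta0.
  exists M => //; rewrite fctE /= /series/= form_im mulNr opprK lerNl.
  by have := hM _ (Im_mul_conj_le (u M.+1) (u M)); rewrite ler_norml => /andP[]; lra.
apply: (frequently_ge0_lim cv1) => eta N eta0.
have [M NM hM] := frequently_small_boundary lu N eta0.
exists M => //; rewrite /series/= form_im mulNr lerN2.
by have := hM _ (Im_mul_conj_le (u M.+1) (u M)); rewrite ler_norml => /andP[].
Qed.

(** Transfers a lower bound from truncated energies to the form of the operator;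
the energy may keep its boundary term alpha |u(M)|^2, since Green's formula
supplies (M+1+alpha) |u(M)|^2. *)
Lemma form_lower_bound v u c M0 : dom (H v) u ->
  (forall M, (M0 <= M)%N ->
    \sum_(0 <= n < M.+1) (v n + c) * sqnormc (u n) <= cenergy M u) ->
  c * sqnorm u <= complex.Re (inner (act (H v) u) u).
Proof.
move=> [lu lTu] le_energy; have [cv _] := ccvg_inner lTu lu.
have /l2_cvg cu := lu.
have cv1 := cv; rewrite -cvg_shiftS in cv1.
have cu1 : series (fun n => sqnormc (u n)) @ \oo --> sqnorm u := cu.
rewrite -cvg_shiftS in cu1.
rewrite -subr_ge0.
apply: (frequently_ge0_lim (cvgB cv1 (cvgMr (a := c) cu1))) => eta N eta0.
have [M NM hM] := frequently_small_boundary lu (maxn M0 N) eta0.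
move: NM; rewrite geq_max => /andP[M0M NM].
exists M => //=; rewrite /series/= !fctE/= form_re.
have := hM _ (Re_mul_conj_le (u M.+1) (u M)); rewrite ler_norml => /andP[_].
have := le_energy M M0M; rewrite (eq_bigr _ (fun i _ => mulrDl _ _ _)) big_split/=.
rewrite mulr_sumr.
have : 0 <= M.+1%:R * sqnormc (u M) by rewrite mulr_ge0 ?sqnormc_ge0.
lra.
Qed.

End LaguerreForm.

(** * Measures concentrated on a bounded set *)

Section ConcentratedMeasure.
Variables (R : realType) (mu : {measure set (measurableTypeR R) -> \bar R}).
Local Open Scope classical_set_scope.
Variables (B : set (measurableTypeR R)) (K : R).
Hypothesis mB : measurable B.
Hypothesis muC : mu (~` B) = 0%E.
Hypothesis muB : (mu B < +oo)%E.
Hypothesis bounded : forall x : R, B x -> `|x| <= K.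

Lemma ge0_integral_concentrated (f : measurableTypeR R -> \bar R) :
  (forall x, 0 <= f x)%E ->
  measurable_fun [set: measurableTypeR R] f ->
  (\int[mu]_x f x = \int[mu]_(x in B) f x)%E.
Proof.
move=> f0 mf; rewrite (@ge0_negligible_integral _ _ _ mu setT (~` B))//.
  by rewrite setTD setCK.
exact: measurableC.
Qed.

Lemma bounded_integrable_on (f : measurableTypeR R -> R) (C : R) :
  measurable_fun [set: measurableTypeR R] f -> (forall x, B x -> `|f x| <= C) ->
  mu.-integrable B (EFin \o f).
Proof.
move=> mf fC; apply: measurable_bounded_integrable => //.
  exact: measurable_funS mf.
exists C; split; first exact: num_real.
by move=> C' CC' x Bx; apply: le_trans (ltW CC'); exact: fC.
Qed.

Lemma second_moment_concentrated : (\int[mu]_x ((x : R) ^+ 2)%:E < +oo)%E.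
Proof.
have m2 : measurable_fun [set: measurableTypeR R]
    (fun x : measurableTypeR R => (x : R) ^+ 2).
  exact: measurable_funX.
rewrite ge0_integral_concentrated; last 2 first.
- by move=> x; rewrite lee_fin sqr_ge0.
- exact/measurable_EFinP.
apply: integrable_lty => //.
apply: (@bounded_integrable_on _ (K ^+ 2)) => // x Bx.
by rewrite normrX lerXn2r ?nnegrE// ?bounded// (le_trans _ (bounded Bx)).
Qed.

Lemma integrable_concentrated :
  mu.-integrable [set: measurableTypeR R]
    (EFin \o (fun x : measurableTypeR R => (x : R))).
Proof.
apply/integrableP; split; first exact/measurable_EFinP.
have -> : (\int[mu]_x `|(EFin \o (fun x : measurableTypeR R => (x : R))) x| =
           \int[mu]_(x in B) `|(EFin \o (fun x : measurableTypeR R => (x : R))) x|)%E.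
  rewrite ge0_integral_concentrated//.
  by apply: measurableT_comp => //; exact/measurable_EFinP.
have /integrableP[_] : mu.-integrable B
    (EFin \o (fun x : measurableTypeR R => (x : R))) => //.
by apply: (@bounded_integrable_on _ K) => // x Bx; exact: bounded.
Qed.

Lemma mean_concentrated :
  (\int[mu]_x (x : R) = \int[mu]_(x in B) (x : R))%R.
Proof.
rewrite /Rintegral (@negligible_integral _ _ _ mu setT (~` B))//.
- by rewrite setTD setCK.
- exact: measurableC.
- exact: integrable_concentrated.
Qed.

Lemma mean_le (s : R) : (forall x : R, B x -> x <= s) ->
  \int[mu]_x (x : R) <= s * fine (mu B).
Proof.
move=> Bs; rewrite mean_concentrated -Rintegral_cst//.
apply: le_Rintegral => //.
- by apply: (@bounded_integrable_on _ K) => // x Bx; exact: bounded.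
- by apply: (@bounded_integrable_on _ `|s|) => //; exact: measurable_cst.
Qed.

Lemma mean_ge0_null : (forall x : R, B x -> x < 0) ->
  0 <= \int[mu]_x (x : R) -> mu B = 0%E.
Proof.
move=> Bneg; rewrite mean_concentrated => mean0.
have iB : mu.-integrable B (EFin \o (fun x : measurableTypeR R => (x : R))).
  by apply: (@bounded_integrable_on _ K) => // x Bx; exact: bounded.
have mid : measurable_fun B (fun x : measurableTypeR R => (x : R)%:E).
  by apply/measurable_EFinP.
have abs0 : (\int[mu]_(x in B) `|(x : R)%:E| = 0)%E.
  apply/eqP; rewrite eq_le integral_ge0// andbT.
  have -> : (\int[mu]_(x in B) `|(x : R)%:E| = - \int[mu]_(x in B) (x : R)%:E)%E.
    rewrite -integralN; last exact: integrable_add_def.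
    apply: eq_integral => x; rewrite inE => Bx.
    by rewrite lte0_abs// lte_fin; exact: Bneg.
  rewrite leeNl oppe0 -(fineK (integrable_fin_num mB iB)) lee_fin.
  exact: mean0.
have := (ae_eq_integral_abs mu mB mid).1 abs0.
move=> [N [mN N0 BN]].
apply/eqP; rewrite -measure_le0 -N0; apply: le_measure; rewrite ?inE//.
move=> x Bx; apply: BN => /=; apply/not_implyP; split=> //.
by move=> [x0]; have := Bneg _ Bx; rewrite x0 ltxx.
Qed.

End ConcentratedMeasure.

(** * The range of the negative spectral projection *)

Section NegativeSpectralSubspace.
Variable R : realType.
Local Open Scope classical_set_scope.
Local Open Scope complex_scope.
Variables (H : operator R) (E : spectral_resolution H).
Implicit Types (u : cseq R) (B : set (measurableTypeR R)).

Lemma smeasT u : l2 u -> smeas E u setT = (sqnorm u)%:E.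
Proof. by move=> lu; rewrite smeasE// sprojT// inner_self. Qed.

Lemma smeas_lty u B : measurable B -> l2 u -> (smeas E u B < +oo)%E.
Proof. by move=> mB lu; rewrite smeasE// ltry. Qed.

Lemma smeas_range u B : measurable B -> l2 u -> sproj E B u = u ->
  smeas E u B = (sqnorm u)%:E.
Proof. by move=> mB lu uB; rewrite smeasE// uB inner_self. Qed.

Lemma smeas_range_compl u B : measurable B -> l2 u -> sproj E B u = u ->
  smeas E u (~` B) = 0%E.
Proof.
move=> mB lu uB.
have : smeas E u (~` B `|` B) = (smeas E u (~` B) + smeas E u B)%E.
  by apply: measureU; rewrite ?setICl//; exact: measurableC.
rewrite setvU smeasT// (smeas_range mB lu uB) => /(congr1 (fun x => x - (sqnorm u)%:E)%E).
by rewrite addeK// subee.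
Qed.

Lemma concentrated_dom u B (K : R) : measurable B -> l2 u ->
  smeas E u (~` B) = 0%E -> (forall x : R, B x -> `|x| <= K) -> dom H u.
Proof.
move=> mB lu uB BK; apply/(sdom E); split=> //.
by apply: second_moment_concentrated BK => //; exact: smeas_lty.
Qed.

Lemma dom_l2 u : dom H u -> l2 u.
Proof. by move=> /(sdom E)[]. Qed.

Lemma Re_form u : dom H u ->
  complex.Re (inner (act H u) u) = \int[smeas E u]_x (x : R).
Proof. by move=> /(sact E)[_ ->]. Qed.

Lemma bounded_below_form : bounded_below H ->
  exists m : R, forall u, dom H u -> m * sqnorm u <= complex.Re (inner (act H u) u).
Proof.
move=> [m hm]; exists m => u du; have := hm u du.
rewrite inner_self; last exact: dom_l2.
by rewrite -rmorphM/= lecE => /andP[_].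
Qed.

(** The projection w of u onto a bounded slice below m - 1 lies in the domain, and
its mean energy is both at least m and at most m - 1; hence w = 0. *)
Lemma smeas_below_null (m : R) u :
  (forall w, dom H w -> m * sqnorm w <= complex.Re (inner (act H w) w)) ->
  l2 u -> smeas E u `]-oo, (m - 1)[ = 0%E.
Proof.
move=> hm lu.
(* The half-line is exhausted by bounded slices, on which the second moment is finite. *)
have slice (k : nat) : smeas E u `[(m - 1 - k%:R), (m - 1)[ = 0%E.
  set B := (X in smeas E u X).
  have mB : measurable B by exact: measurable_itv.
  have [Pl2 _ Pidem Psym] := sproj_orth E mB.
  set w := sproj E B u; have lw : l2 w by exact: Pl2.
  have wB : sproj E B w = w by exact: Pidem.
  have BK (x : R) : B x -> `|x| <= `|m - 1 - k%:R| + `|m - 1|.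
    rewrite /B /= in_itv /= => /andP[ax xb].
    have := ler_norm (m - 1); have := ler_norm (- (m - 1 - k%:R)); rewrite normrN.
    have := normr_ge0 (m - 1); have := normr_ge0 (m - 1 - k%:R).
    by move=> ? ? ? ?; rewrite ler_norml; apply/andP; split; lra.
  have wC := smeas_range_compl mB lw wB.
  have dw := concentrated_dom mB lw wC BK.
  have := hm _ dw; rewrite Re_form// => lower.
  have Bs (x : R) : B x -> x <= m - 1.
    by rewrite /B /= in_itv/= => /andP[_ /ltW].
  have := mean_le mB wC (smeas_lty mB lw) BK Bs.
  rewrite (smeas_range mB lw wB)/= => upper.
  have w0 : sqnorm w <= 0 by lra.
  have -> : smeas E u B = (sqnorm w)%:E.
    by rewrite smeasE// -/w -{1}wB Psym// inner_self.
  by congr (_%:E); apply/eqP; rewrite eq_le w0 sqnorm_ge0.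
apply/negligibleP; first exact: measurable_itv.
apply: (negligibleS (mu := smeas E u) (A := \bigcup_k `[(m - 1 - k%:R), (m - 1)[)).
  move=> x; rewrite /= in_itv /= => xm.
  exists (Num.trunc (m - 1 - x)).+1 => //=.
  rewrite in_itv/= xm andbT.
  by have := truncnS_gt (m - 1 - x); lra.
apply: negligible_bigcup => k; apply/negligibleP; first exact: measurable_itv.
exact: slice.
Qed.

(** By the lower bound the spectral measure of u is carried by [m - 1, 0[, so u has
a finite second moment and lies in the domain, and its mean is negative
unless the measure is zero. *)
Lemma negative_subspace_form u : bounded_below H -> l2 u ->
  sproj E `]-oo, 0[ u = u ->
  dom H u /\ (0 <= complex.Re (inner (act H u) u) -> forall n, u n = 0).
Proof.
move=> /bounded_below_form[m hm] lu uneg.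
have uC := smeas_range_compl (measurable_itv _) lu uneg.
pose B : set (measurableTypeR R) := `[(m - 1), 0[.
have mB : measurable B by exact: measurable_itv.
have BC : smeas E u (~` B) = 0%E.
  apply/negligibleP; first exact: measurableC.
  apply: (negligibleS (mu := smeas E u) (A := `]-oo, (m - 1)[ `|` ~` `]-oo, 0[)).
    move=> x Bx; have [h|h] := ltP (x : R) (m - 1).
      by left; rewrite /= in_itv.
    by right=> /=; rewrite in_itv/= => x0; apply: Bx; rewrite /B/= in_itv/= h.
  apply: negligibleU; apply/negligibleP => //.
  - exact: smeas_below_null.
  - exact: measurableC.
have BK (x : R) : B x -> `|x| <= `|m - 1|.
  rewrite /B /= in_itv /= => /andP[ax xb].
  have := ler_norm (- (m - 1)); rewrite normrN => ?.
  by rewrite ler_norml; apply/andP; split; lra.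
have du := concentrated_dom mB lu BC BK.
split=> // form0; apply: sqnorm_eq0 => //.
rewrite Re_form// in form0.
have muB : smeas E u B = 0%E.
  apply: (mean_ge0_null mB BC (smeas_lty mB lu) BK) form0 => x.
  by rewrite /B /= in_itv/= => /andP[].
have : smeas E u (~` B `|` B) = (smeas E u (~` B) + smeas E u B)%E.
  by apply: measureU; rewrite ?setICl//; exact: measurableC.
by rewrite setvU smeasT// BC muB adde0 -lee_fin => ->.
Qed.

End NegativeSpectralSubspace.

(** * The count of negative spectrum *)

Section Potential.
Variables (R : realType) (alpha : R).
Hypothesis alpha_gt0 : 0 < alpha.
Local Open Scope classical_set_scope.
Local Open Scope complex_scope.
Implicit Types (u w : cseq R) (v : nat -> R) (n M : nat).

Local Notation H v := (laguerre alpha v).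

Definition weighted_term v n : R := vpos v n `^ (1 + alpha) * sigma2 alpha n.

Lemma weighted_term_ge0 v n : 0 <= weighted_term v n.
Proof. by rewrite mulr_ge0 ?powR_ge0// ltW// sigma2_gt0. Qed.

Lemma vpos_ge0 v n : 0 <= vpos v n.
Proof.
rewrite /vpos divr_ge0// -(subrr `|v n|) lerD2l lerNl.
by rewrite -normrN ler_norm.
Qed.

Lemma le_vpos v n : v n <= vpos v n.
Proof. by rewrite /vpos ler_pdivlMr//; have := ler_norm (v n); lra. Qed.

Lemma weighted_lp_cvg v : weighted_lp (1 + alpha) (sigma2 alpha) (vpos v) ->
  cvgn (series (weighted_term v)).
Proof.
rewrite /weighted_lp/=; under eq_eseriesr do rewrite ger0_norm ?vpos_ge0//.
by move=> /(nneseries_lt_pinftyP (weighted_term_ge0 v)).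
Qed.

Lemma potential_le v n (s : R) : 0 < s -> v n <= s + weighted_term v n / s `^ alpha.
Proof.
move=> s0; apply: (le_trans (le_vpos v n)).
apply: (le_trans (truncation_le alpha_gt0 (vpos_ge0 v n) s0)).
rewrite lerD2l ler_pM2r ?invr_gt0 ?powR_gt0// ler_peMr ?powR_ge0//.
exact: sigma2_ge1.
Qed.

Lemma potential_bounded v : weighted_lp (1 + alpha) (sigma2 alpha) (vpos v) ->
  exists K : R, forall n, v n <= K.
Proof.
move=> /weighted_lp_cvg cg; exists (1 + limn (series (weighted_term v))) => n.
apply: (le_trans (potential_le v n ltr01)); rewrite powR1 divr1 lerD2l.
apply: le_trans (sum_le_limn n.+1 (weighted_term_ge0 v) cg).
rewrite big_nat_recr//= lerDr; apply: sumr_ge0 => k _.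
exact: weighted_term_ge0.
Qed.

Lemma potential_vanishing v : weighted_lp (1 + alpha) (sigma2 alpha) (vpos v) ->
  forall d : R, 0 < d -> exists N : nat, forall n, (N <= n)%N -> v n <= d.
Proof.
move=> /weighted_lp_cvg /cvg_series_cvg_0 g0 d d0.
have h0 : 0 < d / 2 by rewrite divr_gt0.
have a0 : 0 < (d / 2) `^ alpha by rewrite powR_gt0.
move/(cvgrPdist_le _ _).1 : g0 => /(_ _ (mulr_gt0 h0 a0)) [N _ hN].
exists N => n Nn; apply: (le_trans (potential_le v n h0)).
have := hN n Nn; rewrite sub0r normrN ger0_norm ?weighted_term_ge0//.
by rewrite -ler_pdivrMr//; lra.
Qed.

Lemma cenergy_ge0 M u : 0 <= cenergy alpha M u.
Proof. by rewrite addr_ge0// energy_ge0. Qed.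

Lemma form_bounded_below v u (K : R) : (forall n, v n <= K) -> dom (H v) u ->
  - K * sqnorm u <= complex.Re (inner (act (H v) u) u).
Proof.
move=> vK du; apply: (form_lower_bound alpha_gt0 (M0 := 0) du) => M _.
apply: le_trans (cenergy_ge0 M u); rewrite -oppr_ge0 -sumrN.
by apply: sumr_ge0 => n _; rewrite -mulNr mulr_ge0 ?sqnormc_ge0// oppr_ge0 subr_le0.
Qed.

Lemma laguerre_bounded_below v :
  weighted_lp (1 + alpha) (sigma2 alpha) (vpos v) -> bounded_below (H v).
Proof.
move=> /potential_bounded[K vK]; exists (- K) => u du.
have [lu _] := du.
rewrite inner_self// -rmorphM/= lecE form_imaginary_part//= eqxx/=.
exact: form_bounded_below.
Qed.

(** The constant eps depends on alpha only; it is the inverse of the constant in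
the final bound. *)
Lemma form_ge0_off_points : exists2 eps : R, 0 < eps &
  forall v, weighted_lp (1 + alpha) (sigma2 alpha) (vpos v) ->
    exists Z : seq nat, (size Z)%:R * eps <= limn (series (weighted_term v)) /\
      forall u, dom (H v) u -> (forall n, n \in Z -> u n = 0) ->
        0 <= complex.Re (inner (act (H v) u) u).
Proof.
have [eps eps0 pts] := dirichlet_points alpha_gt0; exists eps => // v lpv.
have cg := weighted_lp_cvg lpv.
have [Z [m [sZ vanish]]] := pts _ _ (vpos_ge0 v)
  (fun M => sum_le_limn M (weighted_term_ge0 v) cg).
exists Z; split=> // u du uZ; rewrite -(mul0r (sqnorm u)).
apply: (form_lower_bound alpha_gt0 (M0 := m) du) => M mM.
apply: le_trans (lerD (vanish (re_seq u) _ M mM) (vanish (im_seq u) _ M mM)).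
- rewrite -big_split/=; apply: ler_sum => n _.
  rewrite -mulrDr addr0 ler_wpM2r ?le_vpos// addr_ge0 ?sqr_ge0//.
- by move=> n nZ; rewrite /re_seq uZ.
- by move=> n nZ; rewrite /im_seq uZ.
Qed.

(** There are more coefficients than linear conditions. *)
Lemma vanishing_combination (Z : seq nat) k (f : 'I_k -> cseq R) :
  (size Z < k)%N ->
  exists c : 'I_k -> R[i], (exists i, c i != 0) /\
    forall n, n \in Z -> \sum_(i < k) c i * f i n = 0.
Proof.
move=> Zk; pose A : 'M[R[i]]_(k, size Z) := \matrix_(i, j) f i (nth 0%N Z j).
have /rowV0Pn[c cA c0] : kermx A != 0.
  rewrite kermx_eq0; apply/negP => /eqP rA.
  by have := rank_leq_col A; rewrite rA leqNgt Zk.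
exists (fun i => c 0 i); split.
  by have /rV0Pn := c0.
move=> n nZ; have idx : (index n Z < size Z)%N by rewrite index_mem.
move/sub_kermxP : cA => /matrixP /(_ 0 (Ordinal idx)); rewrite !mxE => e.
by rewrite -[RHS]e; apply: eq_bigr => i _; rewrite !mxE/= nth_index.
Qed.

Lemma proj_combination (P : cseq R -> cseq R) k (c : 'I_k -> R[i])
    (f : 'I_k -> cseq R) : orthogonal_projection P ->
  (forall i, l2 (f i)) -> (forall i, P (f i) = f i) ->
  P (fun n => \sum_(i < k) c i * f i n) = (fun n => \sum_(i < k) c i * f i n).
Proof.
move=> [_ Plin _ _]; elim: k c f => [|k IH] c f lf Pf.
  under eq_fun do rewrite big_ord0.
  have := Plin (-1) _ _ (l2_0 R) (l2_0 R).
  under [X in P X]eq_fun do rewrite mulr0 addr0.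
  by move=> ->; apply/funext => n; rewrite mulN1r addNr.
under eq_fun do rewrite big_ord_recl.
rewrite Plin//; last by apply: l2_sum.
by rewrite Pf IH.
Qed.

Lemma kappa_neg_le v (E : spectral_resolution (H v)) (Z : seq nat) :
  bounded_below (H v) ->
  (forall u, dom (H v) u -> (forall n, n \in Z -> u n = 0) ->
        0 <= complex.Re (inner (act (H v) u) u)) ->
  (kappa_neg E <= ((size Z)%:R)%:E)%E.
Proof.
move=> bb form0; apply: ge_ereal_sup => _ [k [f [fW fi]] <-].
rewrite lee_fin ler_nat leqNgt; apply/negP => Zk.
have mI : measurable (`]-oo, 0[ : set (measurableTypeR R)) by exact: measurable_itv.
have orth := sproj_orth E mI; have [Pl2 _ Pidem _] := orth.
have lf i : l2 (f i) by have [g lg <-] := fW i; exact: Pl2.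
have Pf i : sproj E `]-oo, 0[ (f i) = f i.
  by have [g lg <-] := fW i; exact: Pidem.
have [c [[i ci] cZ]] := vanishing_combination f Zk.
have Pu := proj_combination c orth lf Pf.
have [du u0] := negative_subspace_form bb (l2_sum c lf) Pu.
by move: ci; rewrite (fi c (u0 (form0 _ du cZ))) eqxx.
Qed.

End Potential.

(** * The recurrence and the coercive problem *)

Section Recurrence.
Variables (R : realType) (alpha : R).
Hypothesis alpha_gt0 : 0 < alpha.
Local Open Scope classical_set_scope.
Local Open Scope complex_scope.
Implicit Types (u w phi psi : cseq R) (v : nat -> R) (x z : R[i]) (n k M N : nat).

Local Notation H v := (laguerre alpha v).
Local Notation b := (offdiag alpha).

Definition shifted v z u n : R[i] := act (H v) u n - z * u n.

Lemma shifted0 v z u : shifted v z u 0 =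
  ((1 + alpha - v 0%N)%:C - z) * u 0%N - (b 0)%:C * u 1%N.
Proof. by rewrite /shifted /= tau0 // rmorphB/=; ring. Qed.

Lemma shiftedS v z u n : shifted v z u n.+1 =
  - (b n)%:C * u n + ((n.+1%:R *+ 2 + 1 + alpha - v n.+1)%:C - z) * u n.+1
  - (b n.+1)%:C * u n.+2.
Proof. by rewrite /shifted /= tauS rmorphB/=; ring. Qed.

Lemma shifted_linear v z c u w n :
  shifted v z (fun n => c * u n + w n) n = c * shifted v z u n + shifted v z w n.
Proof.
case: n => [|n]; first by rewrite !shifted0; ring.
by rewrite !shiftedS; ring.
Qed.

Lemma shifted_potential v v' z u n :
  shifted v z u n = shifted v' z u n - (v n - v' n)%:C * u n.
Proof. by rewrite /shifted/= rmorphB/=; ring. Qed.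

Lemma offdiagC_neq0 n : (b n)%:C != 0 :> R[i].
Proof.
apply/eqP => /(congr1 (@complex.Re R))/= h.
by have := offdiag_gt0 alpha_gt0 n; rewrite h ltxx.
Qed.

Lemma shifted_solve v z w x : exists u, u 0%N = x /\ forall n, shifted v z u n = w n.
Proof.
pose next n (s : R[i] * R[i]) : R[i] * R[i] := (s.2,
  (- (b n)%:C * s.1 + ((n.+1%:R *+ 2 + 1 + alpha - v n.+1)%:C - z) * s.2 - w n.+1)
  / (b n.+1)%:C).
pose init := (x, (((1 + alpha - v 0%N)%:C - z) * x - w 0%N) / (b 0)%:C).
pose fix s n := if n is m.+1 then next m (s m) else init.
have sE n : (s n).2 = (s n.+1).1 by [].
exists (fun n => (s n).1); split=> // -[|n].
  rewrite shifted0 -sE /= [(b 0)%:C * _]mulrC divfK ?offdiagC_neq0//; ring.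
rewrite shiftedS -(sE n.+1) -(sE n) /= [(b n.+1)%:C * _]mulrC.
rewrite divfK ?offdiagC_neq0//; ring.
Qed.

Lemma homogeneous_zero v z u k : u k = 0 -> u k.+1 = 0 ->
  (forall n, (k < n)%N -> shifted v z u n = 0) -> forall n, (k <= n)%N -> u n = 0.
Proof.
move=> uk uk1 hom n kn.
suff : u n = 0 /\ u n.+1 = 0 by case.
elim: n kn => [|n IH]; first by rewrite leqn0 => /eqP k0; rewrite -k0.
rewrite leq_eqVlt => /orP[/eqP<-//|]; rewrite ltnS => kn.
have [un un1] := IH kn; split=> //.
have := hom n.+1 kn; rewrite shiftedS un un1 !mulr0 !add0r => /eqP.
by rewrite oppr_eq0 mulf_eq0 (negbTE (offdiagC_neq0 _)) => /eqP.
Qed.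

Lemma initial_zero v z u : u 0%N = 0 -> (forall n, shifted v z u n = 0) ->
  forall n, u n = 0.
Proof.
move=> u0 hom n; apply: (@homogeneous_zero v z u 0%N) => //.
have := hom 0%N; rewrite shifted0 u0 mulr0 add0r => /eqP.
by rewrite oppr_eq0 mulf_eq0 (negbTE (offdiagC_neq0 _)) => /eqP.
Qed.

Lemma shifted_unique v z u w : u 0%N = w 0%N ->
  (forall n, shifted v z u n = shifted v z w n) -> forall n, u n = w n.
Proof.
move=> uw0 uw n; apply/eqP; rewrite eq_sym -subr_eq0 addrC -mulN1r; apply/eqP.
apply: (@initial_zero v z (fun n => -1 * u n + w n)) => [|m].
  by rewrite uw0 mulN1r addNr.
by rewrite shifted_linear uw mulN1r addNr.
Qed.

Lemma coercive_form v z (d : R) u M : (forall n, v n + complex.Re z <= - d) ->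
  u M.+1 = 0 ->
  d * \sum_(0 <= n < M.+1) sqnormc (u n) <=
  \sum_(0 <= n < M.+1) complex.Re (shifted v z u n * (u n)^*).
Proof.
move=> vz uM.
have -> : \sum_(0 <= n < M.+1) complex.Re (shifted v z u n * (u n)^*) =
  cenergy alpha M u + M.+1%:R * sqnormc (u M)
  + \sum_(0 <= n < M.+1) - (v n + complex.Re z) * sqnormc (u n).
  have := form_re alpha v u M; rewrite uM mul0r/= mulr0 subr0 => e.
  rewrite (eq_bigr (fun n => complex.Re (act (H v) u n * (u n)^*)
     - complex.Re z * sqnormc (u n))); last first.
    move=> n _; rewrite /shifted; case: (act _ _ _) (u n) z {vz} => [? ?] [? ?] [? ?].
    by rewrite /sqnormc/=; ring.
  rewrite sumrB e -addrA; congr (_ + _).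
  by rewrite -sumrN -sumrN -big_split/=; apply: eq_bigr => n _; ring.
rewrite mulr_sumr; apply: (@le_trans _ _
    (\sum_(0 <= n < M.+1) - (v n + complex.Re z) * sqnormc (u n))).
  by apply: ler_sum => n _; rewrite ler_wpM2r ?sqnormc_ge0// lerNr.
by rewrite lerDr addr_ge0 ?mulr_ge0 ?sqnormc_ge0// addr_ge0// energy_ge0.
Qed.

(** From the form bound by the inequality 2 d Re(x conj(y)) <= |x|^2 + d^2 |y|^2,
term by term. *)
Lemma coercive_bound v z (d : R) u M : 0 < d ->
  (forall n, v n + complex.Re z <= - d) -> u M.+1 = 0 ->
  d ^+ 2 * \sum_(0 <= n < M.+1) sqnormc (u n) <=
  \sum_(0 <= n < M.+1) sqnormc (shifted v z u n).
Proof.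
move=> d0 vz uM; have form := coercive_form vz uM.
have : 2 * d * \sum_(0 <= n < M.+1) complex.Re (shifted v z u n * (u n)^*) <=
  \sum_(0 <= n < M.+1) sqnormc (shifted v z u n)
  + d ^+ 2 * \sum_(0 <= n < M.+1) sqnormc (u n).
  rewrite !mulr_sumr -big_split/=; apply: ler_sum => n _.
  case: (shifted v z u n) (u n) => [x y] [x' y']; rewrite /sqnormc/=.
  have := sqr_ge0 (x - d * x'); have := sqr_ge0 (y - d * y'); rewrite !expr2; lra.
have := ler_wpM2l (ltW d0) form; rewrite expr2.
move: (\sum_(0 <= n < M.+1) sqnormc (u n))
  (\sum_(0 <= n < M.+1) sqnormc (shifted v z u n))
  (\sum_(0 <= n < M.+1) complex.Re _) => s t r; lra.
Qed.

Lemma compact_choice (F : nat -> set (R * R)) (p : nat -> R * R) (r : R) :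
  (forall K, closed (F K)) -> (forall K M, (K <= M)%N -> F K (p M)) ->
  (forall M, `|(p M).1| <= r /\ `|(p M).2| <= r) ->
  exists q, forall K, F K q.
Proof.
move=> clF Fp pr.
have cpt : compact (`[- r, r] `*` `[- r, r] : set (R * R)).
  by apply: compact_setX; exact: segment_compact.
have inbox : (p @ \oo) (`[- r, r] `*` `[- r, r]).
  exists 0%N => // M _ /=; rewrite !in_itv /= -!ler_norml.
  by have [-> ->] := pr M.
have [q [_ clq]] := cpt _ _ inbox.
exists q => K; apply: clF => B nB.
have FK : (p @ \oo) (F K) by exists K => // M /= KM; exact: Fp.
exact: clq FK nB.
Qed.

(** Every solution of the recurrence with a given right-hand side has the form
x phi + w, where x is its initial value; a bound on finitely many of its terms is
a closed condition on x. *)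
Lemma affine_sum_closed (phi w : cseq R) (B : R) K :
  closed [set q : R * R |
    \sum_(0 <= n < K) sqnormc ((q.1 +i* q.2) * phi n + w n) <= B].
Proof.
pose f K (q : R * R) : R := \sum_(0 <= n < K) sqnormc ((q.1 +i* q.2) * phi n + w n).
suff cf : continuous (f K).
  by apply: (preimage_closed (f := f K) (D := [set x | x <= B])) => //;
    exact: closed_le.
elim: K => [|K IH].
  rewrite (_ : f 0%N = fun=> 0); first exact: cst_continuous.
  by apply/funext => q; rewrite /f big_geq.
pose P := complex.Re (phi K); pose Q := complex.Im (phi K).
pose S := complex.Re (w K); pose T := complex.Im (w K).
rewrite (_ : f K.+1 = fun q => f K q + ((q.1 * P - q.2 * Q + S) ^+ 2
    + (q.1 * Q + q.2 * P + T) ^+ 2)).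
  have c1 : continuous (fun q : R * R => q.1) by move=> q; exact: cvg_fst.
  have c2 : continuous (fun q : R * R => q.2) by move=> q; exact: cvg_snd.
  move=> q; apply: cvgD; first exact: IH.
  have l1 (s : R) : (fun q : R * R => q.1 * s) q' @[q' --> q] --> q.1 * s.
    by apply: cvgMl; exact: c1.
  have l2 (s : R) : (fun q : R * R => q.2 * s) q' @[q' --> q] --> q.2 * s.
    by apply: cvgMl; exact: c2.
  apply: cvgD; rewrite expr2; under eq_cvg do rewrite expr2.
    by apply: cvgM; apply: cvgD; [apply: cvgB| |apply: cvgB|];
      [exact: l1|exact: l2|exact: cvg_cst|exact: l1|exact: l2|exact: cvg_cst].
  by apply: cvgM; apply: cvgD; [apply: cvgD| |apply: cvgD|];
    [exact: l1|exact: l2|exact: cvg_cst|exact: l1|exact: l2|exact: cvg_cst].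
apply/funext => q; rewrite /f big_nat_recr//=; congr (_ + _).
by rewrite /P /Q /S /T; case: (phi K) (w K) => [? ?] [? ?]; rewrite /sqnormc/=; ring.
Qed.

(** For each M choose the initial value x M for which the solution vanishes at M+1;
[coercive_bound] then controls its terms up to M uniformly in M.  A cluster point
of the x M is the initial value of a square-summable solution. *)
Lemma coercive_solve v z (d : R) w : 0 < d ->
  (forall n, v n + complex.Re z <= - d) -> l2 w ->
  exists u, [/\ l2 u, forall n, shifted v z u n = w n
              & d ^+ 2 * sqnorm u <= sqnorm w].
Proof.
move=> d0 vz lw.
have [p [p0 Lp]] := shifted_solve v z w 0.
have [phi [phi0 Lphi]] := shifted_solve v z (fun=> 0) 1.
have phi_neq0 M : phi M.+1 != 0.
  apply/negP => /eqP /(coercive_bound d0 vz).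
  under [leRHS]eq_bigr do rewrite Lphi /sqnormc/= expr0n/= addr0.
  rewrite big1_eq leNgt => /negP; apply; rewrite mulr_gt0 ?exprn_gt0//.
  rewrite big_nat_recl//= phi0 /sqnormc/= expr1n expr0n/= addr0.
  by rewrite ltr_pwDl// sumr_ge0// => n _; exact: sqnormc_ge0.
pose x M := - p M.+1 / phi M.+1.
have bound K M : (K <= M)%N ->
  \sum_(0 <= n < K.+1) sqnormc (x M * phi n + p n) <= sqnorm w / d ^+ 2.
  move=> KM; rewrite ler_pdivlMr ?exprn_gt0// mulrC.
  have uM : x M * phi M.+1 + p M.+1 = 0 by rewrite divfK// addNr.
  have := coercive_bound (u := fun n => x M * phi n + p n) d0 vz uM.
  under [leRHS]eq_bigr do rewrite shifted_linear Lphi Lp mulr0 add0r.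
  move=> /le_trans /(_ (sum_le_sqnorm M.+1 lw)); apply: le_trans.
  rewrite ler_wpM2l ?sqr_ge0// [leRHS](big_cat_nat (n := K.+1))//= lerDl.
  by apply: sumr_ge0 => n _; exact: sqnormc_ge0.
pose r := 1 + sqnorm w / d ^+ 2.
have xr M : `|complex.Re (x M)| <= r /\ `|complex.Im (x M)| <= r.
  have := bound 0%N M (leq0n M); rewrite big_nat1 phi0 p0 mulr1 addr0 /sqnormc.
  rewrite /r; case: (x M) => X Y /=; move: (_ / _) => s h.
  have := (sqr_ge0 X, sqr_ge0 Y) => -[X0 Y0].
  have := (sqr_ge0 (X - 1), sqr_ge0 (Y - 1), sqr_ge0 (X + 1), sqr_ge0 (Y + 1)).
  move: h X0 Y0; rewrite !expr2 => h X0 Y0 [[[? ?] ?] ?].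
  by split; rewrite ler_norml; apply/andP; split; lra.
have eta (y : R[i]) : complex.Re y +i* complex.Im y = y by case: y.
have [q hq] := compact_choice
  (F := fun K => [set q : R * R | \sum_(0 <= n < K.+1)
     sqnormc ((q.1 +i* q.2) * phi n + p n) <= sqnorm w / d ^+ 2])
  (p := fun M => (complex.Re (x M), complex.Im (x M)))
  (fun K => @affine_sum_closed phi p _ K.+1)
  (fun K M KM => eq_ind_r (fun y => \sum_(0 <= n < K.+1) sqnormc (y * phi n + p n)
      <= sqnorm w / d ^+ 2) (bound K M KM) (eta (x M))) xr.
pose u n := (q.1 +i* q.2) * phi n + p n.
have ub M : \sum_(0 <= n < M) sqnormc (u n) <= sqnorm w / d ^+ 2.
  apply: le_trans (hq M); rewrite [leRHS]big_nat_recr//= lerDl sqnormc_ge0//.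
exists u; split.
- exact: l2_bounded ub.
- by move=> n; rewrite shifted_linear Lphi Lp mulr0 add0r.
- by rewrite mulrC -ler_pdivlMr ?exprn_gt0//; exact: sqnorm_le.
Qed.

End Recurrence.

(** * The resolvent off the eigenvalues *)

Section Resolvent.
Variables (R : realType) (alpha : R).
Hypothesis alpha_gt0 : 0 < alpha.
Local Open Scope classical_set_scope.
Local Open Scope complex_scope.
Implicit Types (u w phi psi : cseq R) (v : nat -> R) (x z : R[i]) (n k M N : nat).

Local Notation H v := (laguerre alpha v).
Local Notation b := (offdiag alpha).
Local Notation shifted := (shifted alpha).

Lemma l2_tail u w k : l2 w -> (forall n, (k <= n)%N -> u n = w n) -> l2 u.
Proof.
move=> lw uw.
apply: (@l2_bounded _ _ (\sum_(0 <= n < k) sqnormc (u n) + sqnorm w)) => M.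
apply: (@le_trans _ _ (\sum_(0 <= n < k + M) sqnormc (u n))).
  rewrite [leRHS](big_cat_nat (n := M))//= ?leq_addl// lerDl.
  by apply: sumr_ge0 => n _; exact: sqnormc_ge0.
rewrite (big_cat_nat (n := k))//= ?leq_addr// lerD2l.
apply: le_trans (sum_le_sqnorm (k + M) lw).
rewrite [leRHS](big_cat_nat (n := k))//= ?leq_addr//.
rewrite -[leLHS]add0r lerD//; first by apply: sumr_ge0 => n _; exact: sqnormc_ge0.
rewrite big_nat_cond [leRHS]big_nat_cond.
by apply: ler_sum => n /andP[/andP[/uw-> _] _].
Qed.

Definition unit_seq k n : R[i] := (n == k)%:R.

Lemma l2_unit k : l2 (unit_seq k).
Proof.
apply: (l2_tail (k := k.+1) (l2_0 R)) => n kn.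
by rewrite /unit_seq gtn_eqF.
Qed.

(** The coercive solution for a unit source at k is homogeneous beyond k.  It cannot
vanish at both k and k+1: it would then solve a finite coercive problem with
zero form, hence vanish up to k, against the source term at k. *)
Lemma decaying_tail v z (d : R) k : 0 < d ->
  (forall n, v n + complex.Re z <= - d) ->
  exists psi, [/\ l2 psi, forall n, (k < n)%N -> shifted v z psi n = 0
                & ~ (psi k = 0 /\ psi k.+1 = 0)].
Proof.
move=> d0 vz; have [psi [lpsi Lpsi _]] := coercive_solve alpha_gt0 d0 vz (l2_unit k).
exists psi; split=> // [n kn|[pk pk1]].
  by rewrite Lpsi /unit_seq gtn_eqF.
have := coercive_form alpha_gt0 vz pk1.
rewrite big_nat_recr//= [X in _ <= X]big_nat_recr//= pk.
have -> : \sum_(0 <= n < k) complex.Re (shifted v z psi n * (psi n)^*) = 0.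
  rewrite big_nat_cond big1// => n /andP[/andP[_ nk] _].
  by rewrite Lpsi /unit_seq ltn_eqF// mul0r.
have -> : complex.Re (shifted v z psi k * 0^*) = 0 by rewrite rmorph0 mulr0.
have -> : sqnormc (0 : R[i]) = 0 by rewrite /sqnormc/= expr0n/= addr0.
rewrite !addr0 pmulr_rle0// => sum0.
have psi0 n : (n < k)%N -> psi n = 0.
  move=> nk; apply: sqnormc_eq0; apply/eqP; rewrite eq_le sqnormc_ge0 andbT.
  apply: le_trans sum0; rewrite (big_cat_nat (n := n.+1))//= big_nat_recr//=.
  rewrite -addrA addrCA lerDl addr_ge0//; apply: sumr_ge0 => j _; exact: sqnormc_ge0.
have := Lpsi k; rewrite /unit_seq eqxx.
case: k pk pk1 psi0 {Lpsi sum0} => [|k] pk pk1 psi0.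
  rewrite shifted0 pk pk1 !mulr0 subr0 => /eqP.
  by rewrite eq_sym oner_eq0.
rewrite shiftedS pk pk1 psi0// !mulr0 subr0 addr0 => /eqP.
by rewrite eq_sym oner_eq0.
Qed.

Lemma tail_combination v z u w k c : u k = c * w k -> u k.+1 = c * w k.+1 ->
  (forall n, (k < n)%N -> shifted v z u n = 0) ->
  (forall n, (k < n)%N -> shifted v z w n = 0) ->
  forall n, (k <= n)%N -> u n = c * w n.
Proof.
move=> uk uk1 Lu Lw n kn; apply/eqP; rewrite eq_sym -subr_eq0 -mulN1r addrC; apply/eqP.
apply: (@homogeneous_zero _ _ alpha_gt0 v z (fun n => -1 * u n + c * w n) k) => //.
- by rewrite uk mulN1r addNr.
- by rewrite uk1 mulN1r addNr.
move=> j kj; rewrite shifted_linear Lu//.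
have := shifted_linear alpha v z c w (fun=> 0) j.
under [X in shifted _ _ X]eq_fun do rewrite addr0.
move=> ->; rewrite Lw// !mulr0 !add0r.
by case: j {kj} => [|j]; [rewrite shifted0|rewrite shiftedS]; rewrite !mulr0 ?addr0 subr0.
Qed.

(** The truncation makes the form of the operator minus z at least -Re z / 2. *)
Definition coercive_potential z v n : R := Num.min (v n) (- complex.Re z / 2).

Lemma coercive_potential_le z v n :
  coercive_potential z v n + complex.Re z <= - (- complex.Re z / 2).
Proof.
have : coercive_potential z v n <= - complex.Re z / 2 by rewrite ge_min lexx orbT.
by lra.
Qed.

(** Beyond N all homogeneous solutions are combinations of phi and the decaying
solution psi: they are independent, as phi is not square-summable.  Subtracting
the phi-part from a solution p of the inhomogeneous recurrence leaves a multiple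
of psi in the tail. *)
Lemma solve_unit v z phi N j : complex.Re z < 0 ->
  (forall n, (N <= n)%N -> v n <= - complex.Re z / 2) ->
  (forall n, shifted v z phi n = 0) -> ~ l2 phi -> (j <= N)%N ->
  exists r, l2 r /\ forall n, shifted v z r n = unit_seq j n.
Proof.
move=> z0 vN Lphi nphi jN.
have d0 : 0 < - complex.Re z / 2 by rewrite divr_gt0// oppr_gt0.
have [psi [lpsi Lpsi' psi_neq0]] := decaying_tail N d0 (coercive_potential_le z v).
have Lpsi n : (N < n)%N -> shifted v z psi n = 0.
  move=> Nn; rewrite (shifted_potential _ _ (coercive_potential z v)) Lpsi'//.
  by rewrite /coercive_potential min_l ?subrr ?mul0r ?subr0// vN// ltnW.
have [p [_ Lp]] := shifted_solve alpha_gt0 v z (unit_seq j) 0.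
have Lp0 n : (N < n)%N -> shifted v z p n = 0.
  by move=> Nn; rewrite Lp /unit_seq gtn_eqF// (leq_ltn_trans jN).
pose D := phi N * psi N.+1 - phi N.+1 * psi N.
have D0 : D != 0.
  apply/eqP => D0.
  (* If the pairs at N and N+1 are dependent, phi is a multiple of psi in the tail. *)
have [c [cN cN1]] : exists c, phi N = c * psi N /\ phi N.+1 = c * psi N.+1.
    have e : phi N * psi N.+1 = phi N.+1 * psi N by apply/eqP; rewrite -subr_eq0 -/D D0.
    have [pN|pN] := eqVneq (psi N) 0.
      have pN1 : psi N.+1 != 0 by apply/eqP => pN1; apply: psi_neq0.
      exists (phi N.+1 / psi N.+1); rewrite divfK//; split=> //.
      move/eqP : e; rewrite pN !mulr0 mulf_eq0 (negbTE pN1) orbF => /eqP->//.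
    exists (phi N / psi N); rewrite divfK//; split=> //.
    by rewrite mulrAC e mulfK.
  apply: nphi; apply: (@l2_tail _ (fun n => c * psi n + 0) N).
    by apply: l2_linear lpsi (l2_0 R).
  move=> n Nn; rewrite addr0.
  exact: (tail_combination cN cN1 (fun n _ => Lphi n) Lpsi Nn).
pose a := (p N * psi N.+1 - p N.+1 * psi N) / D.
pose c := (phi N * p N.+1 - phi N.+1 * p N) / D.
exists (fun n => - a * phi n + p n); split; last first.
  by move=> n; rewrite shifted_linear Lphi Lp mulr0 add0r.
apply: (@l2_tail _ (fun n => c * psi n + 0) N).
  by apply: l2_linear lpsi (l2_0 R).
move=> n Nn; rewrite addr0.
apply: (@tail_combination v z (fun n => - a * phi n + p n) psi N c) => //.
- by rewrite /a /c /D; field.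
- by rewrite /a /c /D; field.
- by move=> m Nm; rewrite shifted_linear Lphi Lp0// mulr0 add0r.
Qed.

(** Controls the correction made in [resolvent_solve].  The bound follows by adding
one site at a time, since a single value of u is at most its norm. *)
Lemma finite_correction_bound (r : nat -> cseq R) (kap : nat -> R[i]) N :
  (forall j, (j < N)%N -> l2 (r j)) ->
  exists2 C : R, 0 <= C & forall u, l2 u ->
    let y n := u n + \sum_(0 <= j < N) kap j * u j * r j n in
    l2 y /\ sqnorm y <= C * sqnorm u.
Proof.
elim: N => [|N IH] lr.
  exists 1 => // u lu y.
  have -> : y = u by apply/funext => n; rewrite /y big_geq// addr0.
  by rewrite mul1r.
have [|C C0 hC] := IH; first by move=> j jN; apply: lr; exact: leqW.
have lrN := lr N (ltnSn N).
exists (2 * (sqnormc (kap N) * sqnorm (r N)) + 2 * C).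
  by rewrite addr_ge0 ?mulr_ge0 ?sqnormc_ge0 ?sqnorm_ge0.
move=> u lu y; have [ly' sy'] := hC u lu.
have -> : y = (fun n => (kap N * u N) * r N n +
    (u n + \sum_(0 <= j < N) kap j * u j * r j n)).
  by apply/funext => n; rewrite /y big_nat_recr//= addrA addrC.
split; first exact: l2_linear.
apply: (le_trans (sqnorm_linear_le _ lrN ly')).
rewrite [leRHS]mulrDl lerD//; last by rewrite -mulrA ler_wpM2l.
rewrite -!mulrA ler_wpM2l// sqnormcM -mulrA ler_wpM2l ?sqnormc_ge0//.
by rewrite mulrC ler_wpM2l ?sqnorm_ge0// term_le_sqnorm.
Qed.

(** Solve first with the truncated potential; the error is supported on the finitely
many sites n < N and is removed by the solutions of [solve_unit]. *)
Lemma resolvent_solve v z phi N : complex.Re z < 0 ->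
  (forall n, (N <= n)%N -> v n <= - complex.Re z / 2) ->
  (forall n, shifted v z phi n = 0) -> ~ l2 phi ->
  exists2 C : R, 0 <= C & forall w, l2 w ->
    exists u, [/\ l2 u, forall n, shifted v z u n = w n & sqnorm u <= C * sqnorm w].
Proof.
move=> z0 vN Lphi nphi.
have d0 : 0 < - complex.Re z / 2 by rewrite divr_gt0// oppr_gt0.
have [r hr] : exists r : nat -> cseq R, forall j, (j <= N)%N ->
    l2 (r j) /\ forall n, shifted v z (r j) n = unit_seq j n.
  have : forall j, exists rj : cseq R, (j <= N)%N ->
      l2 rj /\ forall n, shifted v z rj n = unit_seq j n.
    move=> j; have [jN|_] := leqP j N; last by exists (fun=> 0).
    by have [rj hrj] := solve_unit z0 vN Lphi nphi jN; exists rj.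
  by move=> /choice[r hr]; exists r.
pose kap n := (v n - coercive_potential z v n)%:C.
have lr j : (j < N)%N -> l2 (r j) by move=> /ltnW /hr[].
have [C C0 hC] := finite_correction_bound kap lr.
exists (C / (- complex.Re z / 2) ^+ 2); first by rewrite divr_ge0// sqr_ge0.
move=> w lw.
have [u1 [lu1 Lu1 bu1]] := coercive_solve alpha_gt0 d0 (coercive_potential_le z v) lw.
have [lu su] := hC u1 lu1.
eexists; split; [exact: lu| |].
  move=> n.
  (* The expression is linear, so each r j contributes a unit source at j. *)
have sum_shift K : (K <= N)%N ->
      shifted v z (fun n => u1 n + \sum_(0 <= j < K) kap j * u1 j * r j n) n =
      shifted v z u1 n + \sum_(0 <= j < K) kap j * u1 j * unit_seq j n.
    elim: K => [_|K IH KN].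
      rewrite big_geq// addr0; congr (shifted _ _ _ _).
      by apply/funext => m; rewrite big_geq// addr0.
    rewrite big_nat_recr//= addrA -IH ?(ltnW KN)//.
    have [_ <-] := hr K (ltnW KN); rewrite addrC -shifted_linear.
    congr (shifted _ _ _ _); apply/funext => m.
    by rewrite big_nat_recr//= addrA addrC.
  rewrite sum_shift// (shifted_potential _ _ (coercive_potential z v)) Lu1 -/(kap n).
  have [nN|Nn] := ltnP n N.
    rewrite (bigD1_seq n) ?mem_index_iota ?iota_uniq//= big1.
      by rewrite /unit_seq eqxx mulr1 addr0 subrK.
    by move=> j jn; rewrite /unit_seq eq_sym (negbTE jn) mulr0.
  rewrite big_nat_cond big1.
    by rewrite /kap /coercive_potential min_l ?vN// subrr mul0r subr0 addr0.
  move=> j /andP[/andP[_ jN] _].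
  by rewrite /unit_seq gtn_eqF ?mulr0// (leq_trans jN).
apply: (le_trans su); rewrite -mulrA ler_wpM2l// mulrC.
by rewrite ler_pdivlMr ?exprn_gt0// mulrC.
Qed.

(** A Weyl alternative: either the solution from the left is square-summable, or the
resolvent exists. *)
Lemma spectrum_solution v z : complex.Re z < 0 ->
  (exists N, forall n, (N <= n)%N -> v n <= - complex.Re z / 2) ->
  spectrum (H v) z ->
  exists phi, [/\ phi 0%N = 1, forall n, shifted v z phi n = 0 & l2 phi].
Proof.
move=> z0 [N vN] sz.
have [phi [phi0 Lphi]] := shifted_solve alpha_gt0 v z (fun=> 0) 1.
exists phi; split=> //; apply: contrapT => nphi; apply: sz.
have [C C0 solve] := resolvent_solve z0 vN Lphi nphi.
have domP u : l2 u -> l2 (shifted v z u) -> dom (H v) u.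
  move=> lu lLu; split=> //.
  have := l2_linear z lu lLu; congr l2; apply/funext => n.
  by rewrite /shifted addrC subrK.
have uniq u u' : l2 u -> l2 u' ->
    (forall n, shifted v z u n = shifted v z u' n) -> u = u'.
  move=> lu lu' e; pose dif n := -1 * u n + u' n.
  have ldif : l2 dif by exact: l2_linear.
  have Ldif n : shifted v z dif n = 0 by rewrite shifted_linear e mulN1r addNr.
  have dif_phi n : dif n = dif 0%N * phi n + 0.
    apply: (shifted_unique alpha_gt0 (v := v) (z := z)
      (w := fun n => dif 0%N * phi n + (fun=> 0) n)) => [|m].
      by rewrite phi0 mulr1 addr0.
    rewrite Ldif shifted_linear Lphi mulr0 add0r.
    by case: m => [|m]; [rewrite shifted0|rewrite shiftedS]; rewrite !mulr0 ?addr0 subr0.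
  have dif0 : dif 0%N = 0.
    apply/eqP/negPn/negP => dneq; apply: nphi.
    have := l2_linear (dif 0%N)^-1 ldif (l2_0 R); congr l2; apply/funext => n.
    by rewrite (dif_phi n) !addr0 mulrA mulVf// mul1r.
  apply/funext => n; have := dif_phi n; rewrite dif0 mul0r addr0 /dif mulN1r.
  by move=> /eqP; rewrite addrC subr_eq0 => /eqP.
split.
  move=> w lw; have [u [lu Lu _]] := solve w lw; exists u; split.
    by split=> //; apply: domP => //; rewrite (_ : shifted v z u = w)//; exact/funext.
  by move=> u' [[lu' _] Lu']; apply: uniq => // n; rewrite Lu; exact: esym (Lu' n).
exists (Num.sqrt C) => u [lu lHu].
have lw : l2 (shifted v z u).
  have := l2_linear (- z) lu lHu; congr l2; apply/funext => n.
  by rewrite /shifted mulNr addrC.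
have [u' [lu' Lu' bu']] := solve _ lw.
have uu' : u = u' by apply: uniq => // n; rewrite Lu'.
rewrite /l2norm -sqrtrM//; apply: ler_wsqrtr.
by rewrite -[X in X <= _]/(sqnorm u) {1}uu'.
Qed.

End Resolvent.

(** * Discreteness of the negative spectrum *)

Section DiscreteSpectrum.
Variables (R : realType) (alpha : R).
Hypothesis alpha_gt0 : 0 < alpha.
Local Open Scope classical_set_scope.
Local Open Scope complex_scope.
Implicit Types (u w phi psi : cseq R) (v : nat -> R) (z : R[i]) (s t : R) (n k : nat).

Local Notation H v := (laguerre alpha v).
Local Notation shifted := (shifted alpha).

Lemma inner_scale z u w : l2 u -> l2 w ->
  inner (fun n => z * u n) w = z * inner u w.
Proof.
(* z u is the linear combination (z - 1) u + u. *)
move=> lu lw; have := inner_linear (z - 1) lu lu lw.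
rewrite mulrBl mul1r subrK => <-.
by congr inner; apply/funext => n; rewrite mulrBl mul1r subrK.
Qed.

Definition eigenvector v z phi :=
  [/\ phi 0%N = 1, forall n, shifted v z phi n = 0 & l2 phi].

Lemma eigenvector_act v z phi n : eigenvector v z phi ->
  act (H v) phi n = z * phi n.
Proof. by move=> [_ e _]; apply/eqP; rewrite -subr_eq0; apply/eqP; exact: e. Qed.

Lemma eigenvector_dom v z phi : eigenvector v z phi -> dom (H v) phi.
Proof.
move=> ephi; have [_ _ lphi] := ephi; split=> //.
have := l2_linear z lphi (l2_0 R); congr l2; apply/funext => n.
by rewrite addr0 -(eigenvector_act n ephi).
Qed.

Lemma eigenvector_sqnorm_gt0 v z phi : eigenvector v z phi -> 0 < sqnorm phi.
Proof.
move=> [phi0 _ lphi]; apply: lt_le_trans (term_le_sqnorm 0 lphi).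
by rewrite phi0 /sqnormc/= expr1n expr0n/= addr0.
Qed.

Lemma eigenvalue_real v z phi : eigenvector v z phi -> complex.Im z = 0.
Proof.
move=> ephi; have [_ _ lphi] := ephi.
have := form_imaginary_part alpha_gt0 (eigenvector_dom ephi).
have -> : act (H v) phi = (fun n => z * phi n).
  by apply/funext => n; rewrite (eigenvector_act n ephi).
rewrite inner_scale// inner_self//.
case: z {ephi} (eigenvector_sqnorm_gt0 ephi) => x y /=.
rewrite mulr0 add0r => pos /eqP; rewrite mulf_eq0 => /orP[/eqP//|].
by rewrite gt_eqF.
Qed.

Lemma act_linear v z u w n :
  act (H v) (fun n => z * u n + w n) n = z * act (H v) u n + act (H v) w n.
Proof.
by have := shifted_linear alpha v 0 z u w n; rewrite /shifted !mul0r !subr0.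
Qed.

Lemma act_combination v k (c : 'I_k -> R[i]) (f : 'I_k -> cseq R) n :
  act (H v) (fun n => \sum_(i < k) c i * f i n) n = \sum_(i < k) c i * act (H v) (f i) n.
Proof.
elim: k c f => [|k IH] c f.
  rewrite big_ord0 (_ : (fun _ => _) = fun=> 0); last first.
    by apply/funext => m; rewrite big_ord0.
  by case: n => [|n]; rewrite /= ?tau0 ?tauS !mulr0 ?addr0 !subr0.
rewrite big_ord_recl -IH -act_linear; congr (act _ _ _).
by apply/funext => m; rewrite big_ord_recl.
Qed.

Lemma dom_linear v z u w : dom (H v) u -> dom (H v) w ->
  dom (H v) (fun n => z * u n + w n).
Proof.
move=> [lu lHu] [lw lHw]; split; first exact: l2_linear.
have := l2_linear z lHu lHw; congr l2; apply/funext => n.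
exact: esym (act_linear v z u w n).
Qed.

Lemma dom_combination v k (c : 'I_k -> R[i]) (f : 'I_k -> cseq R) :
  (forall i, dom (H v) (f i)) -> dom (H v) (fun n => \sum_(i < k) c i * f i n).
Proof.
move=> df; split; first by apply: l2_sum => i; have [] := df i.
have := l2_sum c (fun i => (df i).2); congr l2; apply/funext => n.
exact: esym (act_combination v c f n).
Qed.

(** The form of H is real on psi and phi jointly; evaluated on c psi + phi it gives
(s - t) Im(conj(c) <phi, psi>) = 0, and c = 1, i suffice. *)
Lemma eigenvectors_orthogonal v s t phi psi : s != t ->
  eigenvector v s%:C phi -> eigenvector v t%:C psi -> inner phi psi = 0.
Proof.
move=> st ephi epsi; have [_ _ lphi] := ephi; have [_ _ lpsi] := epsi.
have skew (c : R[i]) : complex.Im (c^* * inner phi psi) = 0.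
  pose u n := c * psi n + phi n.
  have lu : l2 u by exact: l2_linear.
  have du : dom (H v) u := dom_linear c (eigenvector_dom epsi) (eigenvector_dom ephi).
  have := form_imaginary_part alpha_gt0 du.
  have -> : act (H v) u = (fun n => (c * t%:C) * psi n + s%:C * phi n).
    apply/funext => n; rewrite act_linear (eigenvector_act n epsi).
    by rewrite (eigenvector_act n ephi) mulrA.
  have lsphi : l2 (fun n => s%:C * phi n).
    have := l2_linear s%:C lphi (l2_0 R); congr l2.
    by apply/funext => n; rewrite addr0.
  rewrite inner_linear// inner_scale//.
  rewrite (inner_conj lu lpsi) (inner_conj lu lphi) !inner_linear//.
  rewrite !inner_self// (inner_conj lphi lpsi).
  case: c {u lu du} (inner phi psi) => [a b] [x y] /= e.
  have : (s - t) * (a * y - b * x) = 0 by rewrite -[RHS]e; ring.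
  move/eqP; rewrite mulf_eq0 subr_eq0 (negbTE st)/= => /eqP h.
  by rewrite -[RHS]h; ring.
have := skew 1; have := skew 'i; case: (inner phi psi) => x y /=.
rewrite !mul0r !mul1r oppr0 mul0r add0r addr0 mulN1r => /eqP.
by rewrite oppr_eq0 => /eqP -> ->.
Qed.

(** Otherwise some nonzero combination of the eigenvectors vanishes on Z, although by
orthogonality the form is negative on it. *)
Lemma negative_eigenvalues_bound v (Z : seq nat) (l : seq R) :
  (forall u, dom (H v) u -> (forall n, n \in Z -> u n = 0) ->
     0 <= complex.Re (inner (act (H v) u) u)) ->
  uniq l -> (forall s, s \in l -> s < 0 /\ exists phi, eigenvector v s%:C phi) ->
  (size l <= size Z)%N.
Proof.
move=> form0 ul neg; rewrite leqNgt; apply/negP => Zl.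
pose s (i : 'I_(size l)) := nth 0 l i.
have sl i : s i \in l by exact: mem_nth.
have [e he] : exists e : 'I_(size l) -> cseq R, forall i, eigenvector v (s i)%:C (e i).
  have : forall i, exists phi, eigenvector v (s i)%:C phi.
    by move=> i; have [_] := neg _ (sl i).
  by move=> /choice[e he]; exists e.
have le i : l2 (e i) by have [] := he i.
have s_inj i j : i != j -> s i != s j by rewrite nth_uniq.
have [c [[i0 ci0] cZ]] := vanishing_combination e Zl.
pose u n := \sum_(i < size l) c i * e i n.
have lu : l2 u by exact: l2_sum.
have du : dom (H v) u by apply: dom_combination => i; exact: eigenvector_dom (he i).
have := form0 u du cZ.
have -> : act (H v) u = (fun n => \sum_(i < size l) (c i * (s i)%:C) * e i n).
  apply/funext => n; rewrite act_combination; apply: eq_bigr => i _.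
  by rewrite (eigenvector_act n (he i)) mulrA.
rewrite inner_sum//.
have inner_eu i : inner (e i) u = ((c i) * (sqnorm (e i))%:C)^*.
  rewrite (inner_conj lu (le i)) inner_sum// (bigD1 i)//= big1 ?addr0 ?inner_self//.
  by move=> j ji; rewrite (eigenvectors_orthogonal (s_inj _ _ ji) (he j) (he i)) mulr0.
have -> : \sum_(i < size l) c i * (s i)%:C * inner (e i) u =
    (\sum_(i < size l) s i * (sqnormc (c i) * sqnorm (e i)))%:C.
  rewrite rmorph_sum/=; apply: eq_bigr => i _; rewrite inner_eu.
  by case: (c i) => x y; rewrite /sqnormc /=; congr (_ +i* _); ring.
have pos i : 0 < sqnorm (e i) := eigenvector_sqnorm_gt0 (he i).
have term i : s i * (sqnormc (c i) * sqnorm (e i)) <= 0.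
  have [si _] := neg _ (sl i).
  by rewrite mulr_le0_ge0 ?(ltW si)// mulr_ge0 ?sqnormc_ge0// ltW.
rewrite /= (bigD1 i0)//= leNgt => /negP; apply.
rewrite -[X in _ < X]addr0; apply: ltr_leD; last by apply: sumr_le0 => i _; exact: term.
have [si _] := neg _ (sl i0).
rewrite nmulr_rlt0// mulr_gt0// lt_neqAle sqnormc_ge0 andbT eq_sym.
by apply/eqP => /sqnormc_eq0 /eqP; rewrite (negbTE ci0).
Qed.

(** If t were approached, points of P could be added one at a time, each closer to t
than all the previous ones. *)
Lemma bounded_seqs_isolated (P : R -> Prop) (N : nat) t :
  (forall l, uniq l -> (forall s, s \in l -> P s) -> (size l <= N)%N) ->
  exists2 e : R, 0 < e & forall s, P s -> `|s - t| < e -> s = t.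
Proof.
move=> bound; apply: contrapT => noe.
have close (e : R) : 0 < e -> exists s, [/\ P s, s != t & `|s - t| < e].
  move=> e0; apply: contrapT => nos; apply: noe; exists e => // s Ps st.
  by apply: contrapT => /eqP neq; apply: nos; exists s.
have gap (l : seq R) : t \notin l ->
    exists2 e : R, 0 < e & forall s, s \in l -> e <= `|s - t|.
  elim: l => [|x l IH]; first by exists 1.
  rewrite inE negb_or eq_sym => /andP[xt /IH[e e0 he]].
  exists (Num.min e `|x - t|).
    by rewrite lt_min e0/= normr_gt0 subr_eq0.
  by move=> s; rewrite inE ge_min => /orP[/eqP->|/he->//]; rewrite lexx orbT.
have long k : exists l, [/\ uniq l, size l = k, t \notin l & forall s, s \in l -> P s].
  elim: k => [|k [l [ul sl tl Pl]]]; first by exists [::].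
  have [e e0 he] := gap l tl; have [s [Ps st sclose]] := close e e0.
  exists (s :: l); split=> /=.
  - rewrite ul andbT; apply/negP => /he.
    by rewrite leNgt sclose.
  - by rewrite sl.
  - by rewrite inE negb_or eq_sym st.
  - by move=> x; rewrite inE => /orP[/eqP->//|/Pl].
have [l [ul sl _ Pl]] := long N.+1.
by have := bound l ul Pl; rewrite sl ltnn.
Qed.

(** An eigenvector is determined by its value at 0, so the eigenspace is a line. *)
Lemma eigenspace_edim v z phi : eigenvector v z phi ->
  (0 < edim (Defs.eigenspace (H v) z) < +oo)%E.
Proof.
move=> ephi; have [phi0 _ _] := ephi; apply/andP; split.
  apply: (@lt_le_trans _ _ 1%E) => //; apply: ereal_sup_ubound.
  exists 1%N => //; exists (fun=> phi); split=> [_|c c0 i].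
    by split; [exact: eigenvector_dom ephi|move=> n; exact: eigenvector_act].
  by move: (c0 0%N); rewrite big_ord1 phi0 mulr1 (ord1 i).
apply: (@le_lt_trans _ _ 1%E); last exact: ltry.
apply: ge_ereal_sup => _ [k [f [fW fi]] <-].
rewrite lee_fin -[1]/(1%:R : R) ler_nat leqNgt; apply/negP => k1.
have [c [[i ci] cZ]] := vanishing_combination (Z := [:: 0%N]) f k1.
move: ci; rewrite (fi c) ?eqxx//.
apply: (initial_zero alpha_gt0 (v := v) (z := z)
  (u := fun n => \sum_(i < k) c i * f i n)); first by apply: cZ; rewrite inE.
move=> n; rewrite /shifted act_combination mulr_sumr -sumrB big1// => j _.
by have [_ ->] := fW j; ring.
Qed.

Lemma laguerre_discrete v :
  weighted_lp (1 + alpha) (sigma2 alpha) (vpos v) ->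
  discrete_negative_spectrum (H v).
Proof.
move=> lpv t t0 st.
have small (z : R[i]) : complex.Re z < 0 ->
    exists N : nat, forall n, (N <= n)%N -> v n <= - complex.Re z / 2.
  move=> z0; apply: (potential_vanishing alpha_gt0 lpv).
  by rewrite divr_gt0// oppr_gt0.
have eig (z : R[i]) : complex.Re z < 0 -> spectrum (H v) z ->
    exists phi, eigenvector v z phi.
  by move=> z0 sz; exact: (spectrum_solution alpha_gt0 z0 (small z z0) sz).
split; last by have [phi ephi] := eig t%:C t0 st; exact: eigenspace_edim ephi.
have [eps eps0 pts] := form_ge0_off_points alpha_gt0.
have [Z [_ form0]] := pts v lpv.
have [e e0 he] := bounded_seqs_isolated
  (P := fun s => s < 0 /\ exists phi, eigenvector v s%:C phi) t
  (fun l ul Pl => negative_eigenvalues_bound form0 ul Pl).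
exists (Num.min e (- t)); first by rewrite lt_min e0 oppr_gt0.
move=> z sz zt.
have Rez : `|complex.Re z - t| < Num.min e (- t).
  rewrite -ltcR; apply: le_lt_trans zt.
  by have := normc_ge_Re (z - t%:C); case: (z).
move: Rez; rewrite lt_min => /andP[close neg].
have z0 : complex.Re z < 0 by move: neg; rewrite ltr_norml => /andP[_]; lra.
have [phi ephi] := eig z z0 sz.
have zE : z = (complex.Re z)%:C.
  by have := eigenvalue_real ephi; case: (z) => x y /= ->.
rewrite zE (he (complex.Re z))//; split=> //.
by exists phi; rewrite -zE.
Qed.

End DiscreteSpectrum.

Theorem theorem5p4 (R : realType) (alpha : R) (alpha_gt0 : 0 < alpha) :
  exists C : R, 0 < C /\
    forall v : nat -> R, weighted_lp (1 + alpha) (sigma2 alpha) (vpos v) ->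
      [/\ bounded_below (laguerre alpha v),
          discrete_negative_spectrum (laguerre alpha v)
        & forall E : spectral_resolution (laguerre alpha v),
            (kappa_neg E <=
             C%:E * \sum_(0 <= n <oo)
                      (vpos v n `^ (1 + alpha) * (pochhammer (alpha + 1) n / n`!%:R))%:E)%E].
Proof.
have [eps eps0 pts] := form_ge0_off_points alpha_gt0.
exists eps^-1; split; first by rewrite invr_gt0.
move=> v lpv; have bb := laguerre_bounded_below alpha_gt0 lpv.
split=> //; first exact: laguerre_discrete.
move=> E; have [Z [sZ form0]] := pts v lpv.
apply: (le_trans (kappa_neg_le E bb form0)).
rewrite (nneseries_limn (weighted_term_ge0 alpha_gt0 v) (weighted_lp_cvg alpha_gt0 lpv)).
by rewrite -EFinM lee_fin mulrC ler_pdivlMr.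
Qed.
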